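(* Let $K$ be a field and let $\Lambda$ be a finite-dimensional symmetric $K$-algebra that is also 2-CY-tilted, i.e. $\Lambda = \operatorname{End}_{\mathcal{C}}(T)$ for some cluster-tilting object $T$ in a triangulated 2-Calabi-Yau category $\mathcal{C}$ with suspension functor $\Sigma$. (a) The functor $\Omega^4$ on the stable module category $\underline{\operatorname{mod}}\,\Lambda$ is isomorphic to the identity functor; hence all non-projective $\Lambda$-modules are $\Omega$-periodic with period dividing $4$. (b) The functor $\Sigma^2$ acts as the identity on the objects of $\mathcal{C}$ (i.e. $\Sigma^2 X \simeq X$ for every object $X$ of $\mathcal{C}$). (c) Assume that $\Lambda$ is a Jacobian algebra of a hyperpotential. Then this hyperpotential is rigid if and only if $\Lambda$ is semi-simple.
   Context: $K$ is a field and $D=\operatorname{Hom}_K(-,K)$. A finite-dimensional $K$-algebra $A$ is symmetric if $A\simeq DA$ as $A$-$A$-bimodules. $\operatorname{mod}A$ is the category of finitely generated right $A$-modules; for $A$ self-injective, $\underline{\operatorname{mod}}\,A$ is the stable category (morphisms modulo those factoring through projectives), and $\Omega$ is Heller's syzygy functor on it ($0\to\Omega M\to P_M\to M\to 0$ with $P_M$ a projective cover). $M$ is $\Omega$-periodic if $\Omega^rM\simeq M$ in $\underline{\operatorname{mod}}\,A$ for some $r>0$. Triangulated category $\mathcal{C}$: $K$-linear, with suspension $\Sigma$, finite-dimensional morphism spaces, Krull–Schmidt, and 2-Calabi-Yau, meaning there are functorial isomorphisms $\operatorname{Hom}_{\mathcal{C}}(X,Y)\simeq D\operatorname{Hom}_{\mathcal{C}}(Y,\Sigma^2X)$.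 An object $T$ of $\mathcal{C}$ is cluster-tilting if $\operatorname{Hom}_{\mathcal{C}}(T,\Sigma T)=0$ and every $X$ with $\operatorname{Hom}_{\mathcal{C}}(T,\Sigma X)=0$ lies in $\operatorname{add}T$ (finite direct sums of summands of $T$). An algebra is 2-CY-tilted if it is isomorphic to $\operatorname{End}_{\mathcal{C}}(T)$ for such $\mathcal{C}$, $T$. Let $Q=(Q_0,Q_1,s,t)$ be a finite quiver and $\widehat{KQ}$ its complete path algebra (completion of $KQ$ with respect to the ideal generated by the arrows); paths are written left to right, $e_i$ is the trivial path at $i$. A hyperpotential on $Q$ is a collection $(\rho_\alpha)_{\alpha\in Q_1}$ of elements of $\widehat{KQ}$ such that $\rho_\alpha\in e_j\widehat{KQ}e_i$ for every arrow $\alpha\colon i\to j$, and $\sum_\alpha\alpha\rho_\alpha=\sum_\alpha\rho_\alpha\alpha$ in $\widehat{KQ}$. Its Jacobian algebra is $\widehat{KQ}/\overline{(\rho_\alpha:\alpha\in Q_1)}$, the quotient by the closure of the ideal generated by the $\rho_\alpha$. A hyperpotential with finite-dimensional Jacobian algebra $\Lambda$ is rigid if and only if $\operatorname{HH}_0(\Lambda)=\Lambda/[\Lambda,\Lambda]$ is spanned by the images of the primitive idempotents $e_i$, $i\in Q_0$. *)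

(* Defs.v *)
From HB Require Import structures.
From mathcomp Require Import all_boot all_order all_algebra.
From mathcomp Require Import boolp classical_sets functions.

Set Implicit Arguments.
Unset Strict Implicit.
Unset Printing Implicit Defensive.

Import GRing.Theory.
Local Open Scope ring_scope.

(** * Algebras over a field *)

(* MathComp's [algType] and [falgType] force [1 != 0].  Endomorphism algebras
   and Jacobian algebras may vanish, so finite-dimensional associative unital
   algebras are introduced here without that requirement. *)
Record fdAlgType (K : fieldType) := FdAlgType {
  alg_space : vectType K;
  alg_one : alg_space;
  alg_mul : alg_space -> alg_space -> alg_space;
  alg_mulA : associative alg_mul;
  alg_mul1l : left_id alg_one alg_mul;
  alg_mul1r : right_id alg_one alg_mul;
  alg_mulDl : left_distributive alg_mul +%R;
  alg_mulDr : right_distributive alg_mul +%R;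
  alg_scaleAl : forall k x y, k *: alg_mul x y = alg_mul (k *: x) y;
  alg_scaleAr : forall k x y, k *: alg_mul x y = alg_mul x (k *: y)
}.

Definition alg_sort (K : fieldType) (A : fdAlgType K) : Type := alg_space A.
Coercion alg_sort : fdAlgType >-> Sortclass.

HB.instance Definition _ (K : fieldType) (A : fdAlgType K) :=
  Vector.copy (alg_sort A) (alg_space A).
HB.instance Definition _ (K : fieldType) (A : fdAlgType K) :=
  GRing.Zmodule_isPzRing.Build (alg_sort A)
    (@alg_mulA K A) (@alg_mul1l K A) (@alg_mul1r K A)
    (@alg_mulDl K A) (@alg_mulDr K A).

(* [A] and [DA] are isomorphic bimodules; the bimodule structure of [DA] is
   [(a phi b) y = phi (b y a)]. *)
Definition symmetric_algebra (K : fieldType) (A : fdAlgType K) : Prop :=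
  exists Phi : {linear A -> 'Hom(A, K^o)},
    bijective Phi /\
    forall a x b y : A, Phi (a * x * b) y = Phi x (b * y * a).

Definition right_ideal (K : fieldType) (A : fdAlgType K) (U : {vspace A}) :=
  forall u a : A, u \in U -> u * a \in U.

Definition simple_right_ideal (K : fieldType) (A : fdAlgType K)
    (U : {vspace A}) : Prop :=
  [/\ right_ideal U, U <> 0%VS &
      forall V : {vspace A}, right_ideal V -> (V <= U)%VS ->
        V = 0%VS \/ V = U].

(* The regular right module is a finite direct sum of simple submodules. *)
Definition semisimple_algebra (K : fieldType) (A : fdAlgType K) : Prop :=
  exists (n : nat) (S : 'I_n -> {vspace A}),
    [/\ forall i, simple_right_ideal (S i),
        directv (\sum_(i < n) S i) &
        (\sum_(i < n) S i)%VS = fullv].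

(** * Finitely generated modules and their stable category *)

Section StableCategory.
Variable R : pzRingType.

Definition finitely_generated (M : lmodType R) : Prop :=
  exists (n : nat) (g : 'I_n -> M), forall x : M,
    exists c : 'I_n -> R, x = \sum_(i < n) c i *: g i.

Record fgmod := FgMod {
  fgmod_sort :> lmodType R;
  fgmod_fg : finitely_generated fgmod_sort
}.

Definition projective (P : fgmod) : Prop :=
  forall (M N : fgmod) (g : {linear M -> N}) (f : {linear P -> N}),
    (forall y, exists x, g x = y) ->
    exists h : {linear P -> M}, forall x, g (h x) = f x.

Definition submodule (M : lmodType R) (U : set M) : Prop :=
  U 0 /\ forall a x y, U x -> U y -> U (a *: x + y).

(* A projective cover: an epimorphism from a projective module whose kernel is
   superfluous. *)
Definition projective_cover (P M : fgmod) (p : {linear P -> M}) : Prop :=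
  [/\ projective P, forall y, exists x, p x = y &
      forall U : set P, submodule U ->
        (forall x, exists u v, [/\ U u, p v = 0 & x = u + v]) ->
        forall x, U x].

(* Morphisms of the stable category are represented by module homomorphisms;
   equality of morphisms is [stable_eq]. *)
Definition stable_eq (M N : fgmod) (f g : {linear M -> N}) : Prop :=
  exists (P : fgmod) (a : {linear M -> P}) (b : {linear P -> N}),
    projective P /\ forall x, f x - g x = b (a x).

Definition lin_id (M : fgmod) : {linear M -> M} := idfun.
Definition lin_comp (L M N : fgmod) (g : {linear M -> N}) (f : {linear L -> M})
  : {linear L -> N} := g \o f.

Definition stable_isomorphism (M N : fgmod) (f : {linear M -> N}) : Prop :=
  exists g : {linear N -> M},
    stable_eq (lin_comp g f) (lin_id M) /\ stable_eq (lin_comp f g) (lin_id N).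

Definition stably_isomorphic (M N : fgmod) : Prop :=
  exists f : {linear M -> N}, stable_isomorphism f.

Record stable_functor := StableFunctor {
  stF :> fgmod -> fgmod;
  stF_map : forall M N : fgmod, {linear M -> N} -> {linear stF M -> stF N};
  stF_eq : forall (M N : fgmod) (f g : {linear M -> N}),
    stable_eq f g -> stable_eq (stF_map f) (stF_map g);
  stF_id : forall M : fgmod, stable_eq (stF_map (lin_id M)) (lin_id (stF M));
  stF_comp : forall (L M N : fgmod) (g : {linear M -> N}) (f : {linear L -> M}),
    stable_eq (stF_map (lin_comp g f)) (lin_comp (stF_map g) (stF_map f))
}.

Definition natural_isomorphic (F G : stable_functor) : Prop :=
  exists eta : forall M : fgmod, {linear F M -> G M},
    (forall M, stable_isomorphism (eta M)) /\
    (forall (M N : fgmod) (f : {linear M -> N}),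
       stable_eq (lin_comp (eta N) (stF_map F f))
                 (lin_comp (stF_map G f) (eta M))).

Lemma trivial_projective : exists P : fgmod, projective P.
Proof.
have fg0 : finitely_generated 'rV[R]_0.
  by exists 0%N, (fun=> 0) => x; exists (fun=> 0); apply/rowP; case.
exists (FgMod fg0) => M N g f _; exists \0 => x /=.
have -> : x = 0 by apply/rowP; case.
by rewrite !raddf0.
Qed.

Lemma stable_eq_ext (M N : fgmod) (f g : {linear M -> N}) :
  f =1 g -> stable_eq f g.
Proof.
move=> fg; have [P projP] := trivial_projective.
by exists P, \0, \0; split=> // x; rewrite fg subrr.
Qed.

Lemma stable_eq_trans (M N : fgmod) (g f h : {linear M -> N}) :
  stable_eq f g -> stable_eq g h -> stable_eq f h.
Proof.
move=> [P [a [b [projP fg]]]] [Q [c [d [projQ gh]]]].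
have fgPQ : finitely_generated (P * Q)%type.
  have [m [s sP]] := fgmod_fg P; have [n [t tQ]] := fgmod_fg Q.
  exists (m + n)%N, (fun i : 'I_(m + n) => match fintype.split i with
                              | inl j => (s j, 0) | inr j => (0, t j) end).
  move=> [x y]; have [cx ->] := sP x; have [cy ->] := tQ y.
  exists (fun i : 'I_(m + n) => match fintype.split i with inl j => cx j | inr j => cy j end).
  rewrite big_split_ord /=.
  have spl (i : 'I_m) : fintype.split (lshift n i) = inl i.
    exact: (unsplitK (inl i)).
  have spr (i : 'I_n) : fintype.split (rshift m i) = inr i.
    exact: (unsplitK (inr i)).
  under [X in _ = X + _]eq_bigr do rewrite spl.
  under [X in _ = _ + X]eq_bigr do rewrite spr.
  apply: injective_projections; rewrite /= !raddf_sum /=.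
    rewrite [X in _ = _ + X]big1 ?addr0 // => i _; exact: scaler0.
  rewrite [X in _ = X + _]big1 ?add0r // => i _; exact: scaler0.
pose S := FgMod fgPQ.
pose iP : P -> S := fun x => (x, 0); pose iQ : Q -> S := fun y => (0, y).
have iP_lin : linear iP.
  by move=> k x y; apply: injective_projections; rewrite /= ?scaler0 ?addr0.
have iQ_lin : linear iQ.
  by move=> k x y; apply: injective_projections; rewrite /= ?scaler0 ?addr0.
pose iPl : {linear P -> S} := HB.pack iP (GRing.isLinear.Build _ _ _ _ _ iP_lin).
pose iQl : {linear Q -> S} := HB.pack iQ (GRing.isLinear.Build _ _ _ _ _ iQ_lin).
pose pP : {linear S -> P} := (fst : {linear (P * Q)%type -> P}).
pose pQ : {linear S -> Q} := (snd : {linear (P * Q)%type -> Q}).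
have projS : projective S.
  move=> X Y u v u_surj.
  have [hP hPu] := projP X Y u (v \o iPl) u_surj.
  have [hQ hQu] := projQ X Y u (v \o iQl) u_surj.
  exists ((hP \o pP) \+ (hQ \o pQ)) => -[x y] /=.
  rewrite (raddfD u); apply: (etrans (congr2 +%R (hPu x) (hQu y))) => /=.
  rewrite -(raddfD v); congr (v _).
  by apply: injective_projections; rewrite /= ?addr0 ?add0r.
exists S, ((iPl \o a) \+ (iQl \o c)), ((b \o pP) \+ (d \o pQ)); split=> // x.
rewrite /= addr0 add0r -fg -gh.
by rewrite addrA subrK.
Qed.

Definition stable_id : stable_functor.
Proof.
refine (@StableFunctor id (fun M N f => f) _ _ _) => //.
- by move=> M; apply: stable_eq_ext.
- by move=> *; apply: stable_eq_ext.
Defined.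

Definition stable_comp (G F : stable_functor) : stable_functor.
Proof.
refine (@StableFunctor (fun M => G (F M))
  (fun M N f => stF_map G (stF_map F f)) _ _ _).
- by move=> M N f g fg; do 2!apply: stF_eq.
- move=> M; apply: stable_eq_trans (stF_id G (F M)).
  exact/stF_eq/stF_id.
- move=> L M N g f; apply: stable_eq_trans (stF_comp G _ _).
  exact/stF_eq/stF_comp.
Defined.

Definition stable_pow (F : stable_functor) (r : nat) : stable_functor :=
  iter r (stable_comp F) stable_id.

(* [Om] is Heller's syzygy functor, for some choice of projective covers:
   [Om M] is the kernel of [P M -> M], and [Om f] is the class of a map [w]
   fitting into a commutative diagram
     0 -> Om M -> P M -> M -> 0
           |w      |g    |f
     0 -> Om N -> P N -> N -> 0. *)
Definition heller_functor (Om : stable_functor) : Prop :=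
  exists (P : fgmod -> fgmod) (p : forall M, {linear P M -> M})
         (i : forall M, {linear Om M -> P M}),
    (forall M, [/\ projective_cover (p M), injective (i M) &
                   forall x, p M x = 0 <-> exists y, i M y = x]) /\
    (forall (M N : fgmod) (f : {linear M -> N}),
       exists (g : {linear P M -> P N}) (w : {linear Om M -> Om N}),
         [/\ forall x, p N (g x) = f (p M x),
             forall y, i N (w y) = g (i M y) &
             stable_eq (stF_map Om f) w]).

(* [r] is the period of [M]: the least positive integer with [Om^r M]
   isomorphic to [M] in the stable category. *)
Definition Omega_period (Om : stable_functor) (M : fgmod) (r : nat) : Prop :=
  [/\ (0 < r)%N, stably_isomorphic (stable_pow Om r M) M &
      forall q : nat, (0 < q < r)%N ->
        ~ stably_isomorphic (stable_pow Om q M) M].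

End StableCategory.

(* Right modules over [A] are left modules over the converse ring. *)
Notation right_fgmod A := (fgmod (alg_sort A)^c).

(** * Triangulated categories *)

(* Morphism spaces are finite-dimensional, being of type [vectType K]. *)
Record linear_category (K : fieldType) := LinearCategory {
  ob :> Type;
  hom : ob -> ob -> vectType K;
  idm : forall X, hom X X;
  hcomp : forall X Y Z, hom Y Z -> hom X Y -> hom X Z;
  comp_assoc : forall W X Y Z (h : hom Y Z) (g : hom X Y) (f : hom W X),
    hcomp h (hcomp g f) = hcomp (hcomp h g) f;
  comp_idl : forall X Y (f : hom X Y), hcomp (idm Y) f = f;
  comp_idr : forall X Y (f : hom X Y), hcomp f (idm X) = f;
  comp_linl : forall X Y Z (f : hom X Y), linear (fun g : hom Y Z => hcomp g f);
  comp_linr : forall X Y Z (g : hom Y Z), linear (fun f : hom X Y => hcomp g f)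
}.
Arguments idm {K l} X.
Arguments hcomp {K l X Y Z}.
Notation "g \c f" := (hcomp g f) (at level 40, left associativity).

Section LinearCategories.
Variables (K : fieldType) (C : linear_category K).

Definition is_iso (X Y : C) (f : hom X Y) : Prop :=
  exists g : hom Y X, g \c f = idm X /\ f \c g = idm Y.

Definition isomorphic (X Y : C) : Prop := exists f : hom X Y, is_iso f.

Definition is_zero_object (Z : C) : Prop := idm Z = 0.

(* [S] is a direct sum of the finite family [X]. *)
Definition is_direct_sum (n : nat) (X : 'I_n -> C) (S : C) : Prop :=
  exists (inj : forall k, hom (X k) S) (prj : forall k, hom S (X k)),
    [/\ forall k, prj k \c inj k = idm (X k),
        forall k l, k != l -> prj k \c inj l = 0 &
        \sum_(k < n) inj k \c prj k = idm S].

Definition additive_category : Prop :=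
  forall (n : nat) (X : 'I_n -> C), exists S, is_direct_sum X S.

Definition is_summand (Y T : C) : Prop :=
  exists Z : C, is_direct_sum (fun k : 'I_2 => if k == ord0 then Y else Z) T.

Definition in_add (T X : C) : Prop :=
  exists (n : nat) (Y : 'I_n -> C),
    (forall k, is_summand (Y k) T) /\ is_direct_sum Y X.

Definition local_endomorphism_ring (X : C) : Prop :=
  idm X <> 0 /\
  forall f g : hom X X, ~ is_iso f -> ~ is_iso g -> ~ is_iso (f + g).

Definition krull_schmidt : Prop :=
  forall X : C, exists (n : nat) (Y : 'I_n -> C),
    (forall k, local_endomorphism_ring (Y k)) /\ is_direct_sum Y X.

End LinearCategories.

Record linear_functor (K : fieldType) (C D : linear_category K) :=
  LinearFunctor {
    fob :> C -> D;
    fmap : forall X Y : C, {linear hom X Y -> hom (fob X) (fob Y)};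
    fmap_id : forall X : C, fmap X X (idm X) = idm (fob X);
    fmap_comp : forall (X Y Z : C) (g : hom Y Z) (f : hom X Y),
      fmap X Z (g \c f) = fmap Y Z g \c fmap X Y f
  }.
Arguments fmap {K C D} l {X Y}.

Definition is_equivalence (K : fieldType) (C D : linear_category K)
    (F : linear_functor C D) : Prop :=
  (forall X Y : C, bijective (@fmap K C D F X Y)) /\
  (forall Z : D, exists X : C, isomorphic (F X) Z).

(* Verdier's axioms TR1 to TR4; [distinguished u v w] says that
   X -u-> Y -v-> Z -w-> Sigma X is a distinguished triangle. *)
Record triangulated_category (K : fieldType) := TriangulatedCategory {
  tricat :> linear_category K;
  tri_additive : additive_category tricat;
  susp : linear_functor tricat tricat;
  susp_equiv : is_equivalence susp;
  distinguished : forall X Y Z : tricat,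
    hom X Y -> hom Y Z -> hom Z (susp X) -> Prop;
  TR1_iso : forall (X Y Z X' Y' Z' : tricat)
      (u : hom X Y) (v : hom Y Z) (w : hom Z (susp X))
      (u' : hom X' Y') (v' : hom Y' Z') (w' : hom Z' (susp X'))
      (f : hom X X') (g : hom Y Y') (h : hom Z Z'),
    distinguished u v w -> is_iso f -> is_iso g -> is_iso h ->
    g \c u = u' \c f -> h \c v = v' \c g -> fmap susp f \c w = w' \c h ->
    distinguished u' v' w';
  TR1_id : forall X Z : tricat, is_zero_object Z ->
    @distinguished X X Z (idm X) 0 0;
  TR1_cone : forall (X Y : tricat) (u : hom X Y),
    exists (Z : tricat) (v : hom Y Z) (w : hom Z (susp X)),
      distinguished u v w;
  TR2 : forall (X Y Z : tricat)
      (u : hom X Y) (v : hom Y Z) (w : hom Z (susp X)),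
    distinguished u v w <-> distinguished v w (- fmap susp u);
  TR3 : forall (X Y Z X' Y' Z' : tricat)
      (u : hom X Y) (v : hom Y Z) (w : hom Z (susp X))
      (u' : hom X' Y') (v' : hom Y' Z') (w' : hom Z' (susp X'))
      (f : hom X X') (g : hom Y Y'),
    distinguished u v w -> distinguished u' v' w' -> g \c u = u' \c f ->
    exists h : hom Z Z', h \c v = v' \c g /\ fmap susp f \c w = w' \c h;
  TR4 : forall (X Y Z X' Y' Z' : tricat) (u : hom X Y) (v : hom Y Z)
      (j : hom Y Z') (k : hom Z' (susp X))
      (l : hom Z X') (i : hom X' (susp Y))
      (m : hom Z Y') (n : hom Y' (susp X)),
    distinguished u j k -> distinguished v l i ->
    distinguished (v \c u) m n ->
    exists (f : hom Z' Y') (g : hom Y' X'),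
      [/\ distinguished f g (fmap susp j \c i),
          f \c j = m \c v, n \c f = k, g \c m = l &
          i \c g = fmap susp u \c n]
}.

Section ClusterTilting.
Variables (K : fieldType) (C : triangulated_category K).

(* Isomorphisms from [Hom(X,Y)] to the dual of [Hom(Y, Sigma^2 X)], natural in
   both [X] and [Y]. *)
Definition calabi_yau2 : Prop :=
  exists phi : forall X Y : C,
      {linear hom X Y -> 'Hom(hom Y (susp C (susp C X)), K^o)},
    (forall X Y, bijective (phi X Y)) /\
    (forall (X X' Y Y' : C) (a : hom X' X) (b : hom Y Y')
       (f : hom X Y) (g : hom Y' (susp C (susp C X'))),
       phi X' Y' (b \c f \c a) g
       = phi X Y f (fmap (susp C) (fmap (susp C) a) \c g \c b)).

Definition cluster_tilting (T : C) : Prop :=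
  (forall f : hom T (susp C T), f = 0) /\
  (forall X : C, (forall f : hom T (susp C X), f = 0) -> in_add T X).

Definition isomorphic_to_End (A : fdAlgType K) (T : C) : Prop :=
  exists phi : {linear A -> hom T T},
    [/\ bijective phi, phi 1 = idm T &
        forall x y : A, phi (x * y) = phi x \c phi y].

End ClusterTilting.

(** * Complete qpath algebras and hyperpotentials *)

Record quiver := Quiver {
  vertex : finType;
  arrow : finType;
  source : arrow -> vertex;
  target : arrow -> vertex
}.
Arguments source {q}.
Arguments target {q}.

Section CompletePathAlgebra.
Variable Q : quiver.

Fixpoint walk (i : vertex Q) (w : seq (arrow Q)) : bool :=
  if w is a :: w' then (source a == i) && walk (target a) w' else true.

(* A qpath is its starting vertex together with its sequence of arrows, written
   from left to right. *)
Definition qpath := {p : vertex Q * seq (arrow Q) | walk p.1 p.2}.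

Definition path_source (p : qpath) : vertex Q := (val p).1.
Definition path_arrows (p : qpath) : seq (arrow Q) := (val p).2.
Definition path_length (p : qpath) : nat := size (path_arrows p).

Lemma walk_take i w k : walk i w -> walk i (take k w).
Proof.
by elim: w i k => [|a w IHw] i [|k] //= /andP[-> /IHw]; apply.
Qed.

Lemma walk_drop i w k :
  walk i w -> walk (last i [seq target a | a <- take k w]) (drop k w).
Proof.
by elim: w i k => [|a w IHw] i [|k] //= /andP[_ /IHw]; apply.
Qed.

Definition path_take (k : nat) (p : qpath) : qpath :=
  exist _ (path_source p, take k (path_arrows p)) (walk_take k (valP p)).

Definition path_drop (k : nat) (p : qpath) : qpath :=
  exist _ (last (path_source p) [seq target a | a <- take k (path_arrows p)],
           drop k (path_arrows p)) (walk_drop k (valP p)).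

Lemma path_take_length k p :
  (k <= path_length p)%N -> path_length (path_take k p) = k.
Proof. by move=> kp; rewrite /path_length /path_arrows /= size_takel. Qed.

Lemma path_drop_length k p : path_length (path_drop k p) = (path_length p - k)%N.
Proof. by rewrite /path_length /path_arrows /= size_drop. Qed.

Lemma path_take0 p : path_take 0 p = exist _ (path_source p, [::]) isT.
Proof. by apply: val_inj; rewrite /= take0. Qed.

Lemma path_drop0 p : path_drop 0 p = p.
Proof.
by apply: val_inj; rewrite /= take0 drop0 /path_source /path_arrows -surjective_pairing.
Qed.

Lemma path_take_size p : path_take (path_length p) p = p.
Proof.
apply: val_inj; rewrite /= take_size /path_source /path_arrows.
by rewrite -surjective_pairing.
Qed.

Lemma path_take_take l k p :
  (l <= k)%N -> path_take l (path_take k p) = path_take l p.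
Proof.
by move=> lk; apply: val_inj; rewrite /= /path_source /path_arrows /= take_takel.
Qed.

Lemma path_take_drop l k p :
  path_drop l (path_take (l + k) p) = path_take k (path_drop l p).
Proof.
apply: val_inj; rewrite /= /path_source /path_arrows /= take_takel ?leq_addr //.
by rewrite addnC take_drop.
Qed.

Lemma path_drop_drop l k p :
  path_drop k (path_drop l p) = path_drop (l + k) p.
Proof.
apply: val_inj; rewrite /= /path_source /path_arrows /= drop_drop addnC.
congr (_, _); rewrite takeD map_cat last_cat.
by [].
Qed.

(* An element of the completion of [KQ] at the ideal generated by the arrows is
   a formal, possibly infinite, linear combination of paths; it is given by its
   coefficients. *)
Definition complete_path_algebra (K : fieldType) : Type := qpath -> K.

End CompletePathAlgebra.
Arguments complete_path_algebra : clear implicits.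

HB.instance Definition _ (Q : quiver) (K : fieldType) :=
  GRing.Lmodule.copy (complete_path_algebra Q K) (qpath Q -> K^o).

Section CompletePathAlgebraRing.
Variables (Q : quiver) (K : fieldType).
Notation KQ := (complete_path_algebra Q K).
Implicit Types (f g h : KQ) (p : qpath Q).

(* The product sums over all factorizations of a path into an initial and a
   final part. *)
Definition cpa_mul f g : KQ := fun p =>
  \sum_(k < (path_length p).+1) f (path_take k p) * g (path_drop k p).

Definition cpa_one : KQ := fun p => (path_length p == 0%N)%:R.

Lemma cpa_mulA : associative cpa_mul.
Proof.
move=> f g h; apply/funext => p; rewrite /cpa_mul; set n := path_length p.
pose F l k := f (path_take l p) * g (path_take k (path_drop l p))
              * h (path_drop (l + k) p).
transitivity (\sum_(0 <= l < n.+1) \sum_(0 <= k < (n - l).+1) F l k).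
  rewrite big_mkord; apply: eq_bigr => l _.
  rewrite big_mkord path_drop_length -/n big_distrr /=; apply: eq_bigr => k _.
  by rewrite path_drop_drop mulrA.
transitivity (\sum_(0 <= k < n.+1) \sum_(0 <= l < k.+1) F l (k - l)%N); last first.
  rewrite big_mkord; apply: eq_bigr => k _.
  have kn : (k <= n)%N by rewrite -ltnS.
  rewrite big_mkord path_take_length // big_distrl /=; apply: eq_bigr => l _.
  have lk : (l <= k)%N by rewrite -ltnS.
  by rewrite /F path_take_take // -path_take_drop subnKC.
under [RHS]eq_big_nat => k /andP[_ kn] do
  rewrite (big_nat_widen _ _ n.+1) //.
rewrite [RHS](exchange_big_dep_nat xpredT) //=.
apply: eq_big_nat => l /andP[_ ln].
rewrite -(big_nat_widenl l 0%N n.+1 xpredT (fun k => F l (k - l)%N)) //.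
rewrite -{3}[l]add0n big_addn subSn //.
by apply: eq_big_nat => k _; rewrite addnK.
Qed.

Lemma cpa_mul1l : left_id cpa_one cpa_mul.
Proof.
move=> f; apply/funext => p; rewrite /cpa_mul /cpa_one big_ord_recl /=.
rewrite path_take_length // eqxx mul1r path_drop0 big1 ?addr0 // => k _.
by rewrite path_take_length ?mul0r.
Qed.

Lemma cpa_mul1r : right_id cpa_one cpa_mul.
Proof.
move=> f; apply/funext => p; rewrite /cpa_mul /cpa_one big_ord_recr /=.
rewrite path_drop_length subnn eqxx mulr1 path_take_size big1 ?add0r // => k _.
by rewrite path_drop_length subn_eq0 leqNgt ltn_ord mulr0.
Qed.

Lemma cpa_mulDl : left_distributive cpa_mul +%R.
Proof.
move=> f g h; apply/funext => p.
transitivity (cpa_mul f h p + cpa_mul g h p) => //; rewrite -big_split /=.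
by apply: eq_bigr => k _; rewrite -mulrDl.
Qed.

Lemma cpa_mulDr : right_distributive cpa_mul +%R.
Proof.
move=> f g h; apply/funext => p.
transitivity (cpa_mul f g p + cpa_mul f h p) => //; rewrite -big_split /=.
by apply: eq_bigr => k _; rewrite -mulrDr.
Qed.

HB.instance Definition _ := GRing.Zmodule_isPzRing.Build KQ
  cpa_mulA cpa_mul1l cpa_mul1r cpa_mulDl cpa_mulDr.

Definition cpa_idempotent (i : vertex Q) : KQ :=
  fun p => (val p == (i, [::]))%:R.

Definition cpa_arrow (a : arrow Q) : KQ :=
  fun p => (val p == (source a, [:: a]))%:R.

Definition hyperpotential (rho : arrow Q -> KQ) : Prop :=
  (forall a : arrow Q, exists x : KQ,
     rho a = cpa_idempotent (target a) * x * cpa_idempotent (source a)) /\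
  \sum_a cpa_arrow a * rho a = \sum_a rho a * cpa_arrow a.

Definition ideal_generated (rho : arrow Q -> KQ) (x : KQ) : Prop :=
  exists s : seq (KQ * arrow Q * KQ), x = \sum_(u <- s) u.1.1 * rho u.1.2 * u.2.

(* The n-th power of the closed arrow ideal consists of the series supported on
   the paths of length at least n; these powers form a basis of neighbourhoods
   of 0. *)
Definition cpa_closure (I : KQ -> Prop) (x : KQ) : Prop :=
  forall n : nat, exists y : KQ,
    I y /\ forall p, (path_length p < n)%N -> (x - y) p = 0.

(* [pi] identifies the quotient of the complete path algebra by the closure of
   the ideal generated by [rho] with [A]. *)
Definition jacobian_presentation (rho : arrow Q -> KQ) (A : fdAlgType K)
    (pi : {linear KQ -> A}) : Prop :=
  [/\ monoid_morphism pi, forall y : A, exists x, pi x = y &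
      forall x, pi x = 0 <-> cpa_closure (ideal_generated rho) x].

Definition commutator_sum (A : fdAlgType K) (x : A) : Prop :=
  exists s : seq (A * A), x = \sum_(u <- s) (u.1 * u.2 - u.2 * u.1).

(* Rigidity of the hyperpotential with Jacobian algebra [A], presented by [pi]:
   [HH_0(A) = A / [A, A]] is spanned by the images of the idempotents e_i. *)
Definition rigid (A : fdAlgType K) (pi : {linear KQ -> A}) : Prop :=
  forall x : A, exists c : vertex Q -> K,
    commutator_sum (x - \sum_i c i *: pi (cpa_idempotent i)).

End CompletePathAlgebraRing.

(* Main.v *)
From HB Require Import structures.
From mathcomp Require Import all_boot all_order all_algebra.
From mathcomp Require Import boolp.
Require Import Defs.

Set Implicit Arguments.
Unset Strict Implicit.
Unset Printing Implicit Defensive.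

Import GRing.Theory.

(** Write S for the suspension, F = Hom(T, -), and let tau be a nondegenerate
    symmetric linear form on Lambda = End(T).  Under the Calabi-Yau duality
    between Hom(T, T) and Hom(T, S^2 T), the form tau is evaluation at some
    eta : T -> S^2 T.  The identity tau(ab) = tau(ba) becomes
    S^2(a) eta = eta a for all a in End(T), and nondegeneracy makes
    a |-> eta a a bijection from End(T) to Hom(T, S^2 T); a cone argument then
    shows that eta is invertible (twist_iso_exists).  So S^2 restricts to the
    identity functor on add T, up to the natural isomorphism induced by eta
    (twist_retract).

    Each X is the cone of a map T1 -> T0 in add T (approximation), and S^2 X is
    the cone of its image under S^2, an isomorphic map.  Hence S^2 X and X are
    isomorphic (susp2_object).  This isomorphism need not be natural in X, but
    F X -> F (S^2 X), x |-> S^2(x) eta, visibly is, and it is bijective because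
    S^2 is fully faithful and eta is invertible (hom_susp2).

    For syzygies, take a triangle Y -> T1 -> T0 -> S Y with T1, T0 in add T.
    Since Hom(S T, T0) and Hom(S T, S^2 T0) are isomorphic via eta and the latter
    is 0, the sequence 0 -> F Y -> F T1 -> F T0 -> F (S Y) -> 0 is exact, with
    projective middle terms, and it is natural in Y (resolution_two_step_map).
    So F Y computes the second syzygy of F (S Y), and F Y, isomorphic to
    F (S^2 Y), computes its own fourth syzygy.  As F is full and reaches all
    modules (hom_full, hom_dense_susp2), the comparison of projective
    resolutions gives an isomorphism between the fourth power of any Heller
    functor and the identity (syzygy4_identity).

    For a Jacobian presentation pi, let J be the image of the arrow ideal; it is
    a nilpotent ideal (pres_nilpotent).  If Lambda is semi-simple then J = 0, and
    Lambda is spanned by the images of the trivial paths, so that the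
    hyperpotential is rigid.  Conversely, rigidity forces J into [Lambda, Lambda]
    and hence into the kernel of tau; being an ideal, J vanishes by
    nondegeneracy, and Lambda is a product of copies of K. *)

(** * Comparison of two-step resolutions *)

Section StableModules.
Local Open Scope ring_scope.
Variable R : pzRingType.
Implicit Types L M N P Q : fgmod R.

Lemma stable_eq_sym M N (f g : {linear M -> N}) :
  stable_eq f g -> stable_eq g f.
Proof.
move=> [P [a [b [projP fg]]]]; exists P, a, (\- b); split=> // x /=.
by rewrite -fg opprB.
Qed.

Lemma stable_eq_compl L M N (g : {linear M -> N}) (f f' : {linear L -> M}) :
  stable_eq f f' -> stable_eq (lin_comp g f) (lin_comp g f').
Proof.
move=> [P [a [b [projP ff']]]]; exists P, a, (g \o b); split=> // x /=.
by rewrite -raddfB ff'.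
Qed.

Lemma stable_eq_compr L M N (g g' : {linear M -> N}) (f : {linear L -> M}) :
  stable_eq g g' -> stable_eq (lin_comp g f) (lin_comp g' f).
Proof.
by move=> [P [a [b [projP gg']]]]; exists P, (a \o f), b; split=> // x /=.
Qed.

Lemma stably_isomorphic_sym M N :
  stably_isomorphic M N -> stably_isomorphic N M.
Proof. by move=> [f [g [gf fg]]]; exists g, f. Qed.

Lemma stable_isomorphism_comp L M N (g : {linear M -> N}) (f : {linear L -> M}) :
  stable_isomorphism f -> stable_isomorphism g ->
  stable_isomorphism (lin_comp g f).
Proof.
move=> [f' [f'f ff']] [g' [g'g gg']]; exists (lin_comp f' g'); split.
- apply: stable_eq_trans f'f.
  apply: (@stable_eq_trans _ _ _ (lin_comp f' (lin_comp (lin_comp g' g) f))).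
    exact: stable_eq_ext.
  apply: stable_eq_compl.
  apply: (@stable_eq_trans _ _ _ (lin_comp (lin_id M) f)).
    exact: stable_eq_compr.
  exact: stable_eq_ext.
- apply: stable_eq_trans gg'.
  apply: (@stable_eq_trans _ _ _ (lin_comp g (lin_comp (lin_comp f f') g'))).
    exact: stable_eq_ext.
  apply: stable_eq_compl.
  apply: (@stable_eq_trans _ _ _ (lin_comp (lin_id M) g')).
    exact: stable_eq_compr.
  exact: stable_eq_ext.
Qed.

Lemma stably_isomorphic_trans M L N :
  stably_isomorphic L M -> stably_isomorphic M N -> stably_isomorphic L N.
Proof.
by move=> [f fi] [g gi]; exists (lin_comp g f); apply: stable_isomorphism_comp.
Qed.

Lemma stable_functor_iso (F : stable_functor R) M N :
  stably_isomorphic M N -> stably_isomorphic (F M) (F N).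
Proof.
move=> [f [g [gf fg]]]; exists (stF_map F f), (stF_map F g); split.
- apply: stable_eq_trans (stF_id F M).
  apply: stable_eq_trans (stF_eq F gf).
  by apply: stable_eq_sym; apply: stF_comp.
- apply: stable_eq_trans (stF_id F N).
  apply: stable_eq_trans (stF_eq F fg).
  by apply: stable_eq_sym; apply: stF_comp.
Qed.

Lemma linear_bijection_inverse (M N : lmodType R) (f : {linear M -> N}) :
  injective f -> (forall y, exists x, f x = y) ->
  exists g : {linear N -> M}, cancel f g /\ cancel g f.
Proof.
move=> f_inj f_surj; pose g y := sval (cid (f_surj y)).
have gK : cancel g f by move=> y; rewrite /g; case: cid.
have g_lin : linear g.
  by move=> k x y; apply: f_inj; rewrite linearP !gK.
pose gl : {linear N -> M} := HB.pack g (GRing.isLinear.Build _ _ _ _ _ g_lin).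
by exists gl; split=> // x; apply: f_inj; rewrite gK.
Qed.

Lemma free_finitely_generated n : finitely_generated ('rV[R]_n : lmodType R).
Proof.
exists n, (fun i => delta_mx 0 i) => x; exists (x 0).
by rewrite [LHS]row_sum_delta.
Qed.

Definition free_module n : fgmod R := FgMod (free_finitely_generated n).

Lemma free_module_map n (M : lmodType R) (m : 'I_n -> M) :
  exists f : {linear free_module n -> M},
    forall x : 'rV[R]_n, f x = \sum_(i < n) x 0 i *: m i.
Proof.
pose f (x : 'rV[R]_n) := \sum_(i < n) x 0 i *: m i.
have f_lin : linear f.
  move=> k x y; rewrite /f scaler_sumr -big_split; apply: eq_bigr => i _ /=.
  by rewrite !mxE scalerDl scalerA.
by exists (HB.pack f (GRing.isLinear.Build _ _ _ _ _ f_lin) : {linear _ -> _}).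
Qed.

(** Projectivity in the category of finitely generated modules is a lifting
    property against epimorphisms.  A lift also exists when [g] only hits the
    image of [f]: choose it on the generators of a free module of which [P] is a
    retract.  This spares introducing the image of [g] as a module. *)
Lemma projective_lift P (M N : lmodType R) (g : {linear M -> N})
    (f : {linear P -> N}) :
  projective P -> (forall x, exists y, g y = f x) ->
  exists h : {linear P -> M}, forall x, g (h x) = f x.
Proof.
move=> projP fg; have [n [e eP]] := fgmod_fg P.
have [q qE] := free_module_map e.
have [s sK] : exists s : {linear P -> free_module n}, forall x, q (s x) = x.
  apply: (projP _ _ q (lin_id P)) => y.
  have [c ->] := eP y; exists (\row_i c i); rewrite qE.
  by apply: eq_bigr => i _; rewrite mxE.
have [m mE] := choice (fun i => fg (e i)).
have [h hE] := free_module_map m.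
exists (h \o s) => x /=; rewrite -[in RHS](sK x) hE qE !linear_sum /=.
by apply: eq_bigr => i _; rewrite !linearZ /= mE.
Qed.

(** An exact sequence 0 -> L -> P1 -> P0 -> M -> 0 with projective middle terms.
    Two steps are taken at once because this is what a triangle provides: the
    intermediate syzygy is the image of [ts_d] and has no name of its own. *)
Record two_step (M L : fgmod R) := TwoStep {
  P1 : fgmod R; P0 : fgmod R;
  ts_i : {linear L -> P1}; ts_d : {linear P1 -> P0}; ts_p : {linear P0 -> M};
  ts_proj1 : projective P1; ts_proj0 : projective P0;
  ts_inj : injective ts_i;
  ts_exact1 : forall x, ts_d x = 0 <-> exists y, ts_i y = x;
  ts_exact0 : forall x, ts_p x = 0 <-> exists y, ts_d y = x;
  ts_surj : forall y, exists x, ts_p x = y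
}.

Definition two_step_map M L M' L' (E : two_step M L) (E' : two_step M' L')
    (f : {linear M -> M'}) (w : {linear L -> L'}) : Prop :=
  exists (g0 : {linear P0 E -> P0 E'}) (g1 : {linear P1 E -> P1 E'}),
    [/\ forall x, ts_p E' (g0 x) = f (ts_p E x),
        forall x, ts_d E' (g1 x) = g0 (ts_d E x) &
        forall x, ts_i E' (w x) = g1 (ts_i E x)].

Lemma two_step_map_exists M L M' L' (E : two_step M L) (E' : two_step M' L')
    (f : {linear M -> M'}) :
  exists w, two_step_map E E' f w.
Proof.
have [g0 g0E] := projective_lift (g := ts_p E') (f := f \o ts_p E)
  (@ts_proj0 _ _ E) (fun=> ts_surj _ _).
have [|g1 g1E] := projective_lift (g := ts_d E') (f := g0 \o ts_d E)
    (@ts_proj1 _ _ E).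
  move=> x; apply/ts_exact0; rewrite g0E /=.
  have -> : ts_p E (ts_d E x) = 0 by apply/ts_exact0; exists x.
  by rewrite raddf0.
have w_ex x : exists y, ts_i E' y = g1 (ts_i E x).
  apply/ts_exact1; rewrite g1E /=.
  have -> : ts_d E (ts_i E x) = 0 by apply/ts_exact1; exists x.
  by rewrite raddf0.
have [w wE] := choice w_ex.
have w_lin : linear w.
  by move=> k x y; apply: (@ts_inj _ _ E'); rewrite linearP !wE !linearP.
pose wl : {linear L -> L'} := HB.pack w (GRing.isLinear.Build _ _ _ _ _ w_lin).
by exists wl, g0, g1.
Qed.

Lemma two_step_map_comp M L M' L' M'' L'' (E : two_step M L)
    (E' : two_step M' L') (E'' : two_step M'' L'')
    (f : {linear M -> M'}) w (f' : {linear M' -> M''}) w' :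
  two_step_map E E' f w -> two_step_map E' E'' f' w' ->
  two_step_map E E'' (lin_comp f' f) (lin_comp w' w).
Proof.
move=> [g0 [g1 [pE dE iE]]] [g0' [g1' [pE' dE' iE']]].
exists (g0' \o g0), (g1' \o g1); split=> x /=.
- by rewrite pE' pE.
- by rewrite dE' dE.
- by rewrite iE' iE.
Qed.

Lemma two_step_map_id M L (E : two_step M L) :
  two_step_map E E (lin_id M) (lin_id L).
Proof. by exists idfun, idfun. Qed.

(** The usual homotopy argument: if [f - f'] factors through a projective module,
    then that factorization lifts to [P0 E'], and after subtracting it the
    difference of two lifts is null-homotopic, so that [w - w'] extends to
    [P1 E]. *)
Lemma two_step_map_stable M L M' L' (E : two_step M L) (E' : two_step M' L')
    (f f' : {linear M -> M'}) w w' :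
  two_step_map E E' f w -> two_step_map E E' f' w' ->
  stable_eq f f' -> stable_eq w w'.
Proof.
move=> [g0 [g1 [pE dE iE]]] [g0' [g1' [pE' dE' iE']]] [Q [a [b [projQ ff']]]].
have [b' b'E] := projective_lift (g := ts_p E') (f := b) projQ
  (fun=> ts_surj _ _).
have pd0 x : ts_p E (ts_d E x) = 0 by apply/ts_exact0; exists x.
have di0 x : ts_d E (ts_i E x) = 0 by apply/ts_exact1; exists x.
pose r : {linear P0 E -> P0 E'} := (g0 \- g0') \- (b' \o (a \o ts_p E)).
have [|s sE] := projective_lift (g := ts_d E') (f := r) (@ts_proj0 _ _ E).
  move=> x; apply/ts_exact0; rewrite /r /= !raddfB /= pE pE' b'E -ff'.
  exact: subrr.
pose r1 : {linear P1 E -> P1 E'} := (g1 \- g1') \- (s \o ts_d E).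
have [|t tE] := projective_lift (g := ts_i E') (f := r1) (@ts_proj1 _ _ E).
  move=> x; apply/ts_exact1; rewrite /r1 /= !raddfB /= dE dE' sE /r /= pd0.
  by rewrite (raddf0 a) (raddf0 b') subr0 subrr.
exists (P1 E), (ts_i E), t; split; first exact: ts_proj1.
move=> x; apply: (@ts_inj _ _ E'); rewrite tE /r1 /= di0 (raddf0 s) subr0.
rewrite (raddfB (ts_i E')); exact: (congr2 (fun y z => y - z) (iE x) (iE' x)).
Qed.

Lemma two_step_map_iso M L M' L' (E : two_step M L) (E' : two_step M' L')
    (f : {linear M -> M'}) w :
  two_step_map E E' f w -> stable_isomorphism f -> stable_isomorphism w.
Proof.
move=> fw [g [gf fg]]; have [v gv] := two_step_map_exists E' E g.
exists v; split.
- exact: two_step_map_stable (two_step_map_comp fw gv) (two_step_map_id E) gf.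
- exact: two_step_map_stable (two_step_map_comp gv fw) (two_step_map_id E') fg.
Qed.

Lemma heller_two_step (Om : stable_functor R) : heller_functor Om ->
  exists E : forall M, two_step M (Om (Om M)),
    forall M N (f : {linear M -> N}), exists w,
      two_step_map (E M) (E N) f w /\ stable_eq (stF_map Om (stF_map Om f)) w.
Proof.
move=> [P [p [i [exP mapP]]]].
have ex1 M : projective (P M) by have [[]] := exP M.
have ex2 M y : exists x, p M x = y by have [[_ + _] _ _] := exP M; apply.
have ex3 M : injective (i M) by have [] := exP M.
have ex4 M x : p M x = 0 <-> exists y, i M y = x by have [] := exP M.
have exact1 M x : i M (p (Om M) x) = 0 <-> exists y, i (Om M) y = x.
  rewrite -ex4; split=> [ix0|->]; last exact: raddf0.
  by apply: (@ex3 M); rewrite ix0 raddf0.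
have exact0 M x : p M x = 0 <-> exists y, i M (p (Om M) y) = x.
  rewrite ex4; split=> [[y <-]|[y <-]]; last by exists (p _ y).
  by have [z <-] := ex2 _ y; exists z.
pose E M : two_step M (Om (Om M)) := @TwoStep _ _ (P (Om M)) (P M) (i (Om M))
  (i M \o p (Om M)) (p M) (ex1 _) (ex1 _) (ex3 _) (exact1 M) (exact0 M) (ex2 M).
exists E => M N f.
have [g0 [w0 [pE iE fw0]]] := mapP _ _ f.
have [g1 [w1 [pE1 iE1 fw1]]] := mapP _ _ w0.
exists w1; split; last by apply: stable_eq_trans fw1; apply: stF_eq.
by exists g0, g1; split=> //= x; rewrite pE1 iE.
Qed.

End StableModules.

(** * Linear categories *)

Section LinearCategoryTheory.
Local Open Scope ring_scope.
Variables (K : fieldType) (C : linear_category K).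
Implicit Types X Y Z T : C.

Definition precomp X Y Z (f : hom X Y) : {linear hom Y Z -> hom X Z} :=
  HB.pack (fun g : hom Y Z => g \c f)
    (GRing.isLinear.Build _ _ _ _ _ (comp_linl (Z := Z) f)).
Definition postcomp X Y Z (g : hom Y Z) : {linear hom X Y -> hom X Z} :=
  HB.pack (fun f : hom X Y => g \c f)
    (GRing.isLinear.Build _ _ _ _ _ (comp_linr (X := X) g)).

Lemma comp0l X Y Z (f : hom X Y) : (0 : hom Y Z) \c f = 0.
Proof. exact: (raddf0 (precomp Z f)). Qed.
Lemma comp0r X Y Z (g : hom Y Z) : g \c (0 : hom X Y) = 0.
Proof. exact: (raddf0 (postcomp X g)). Qed.
Lemma compNl X Y Z (g : hom Y Z) (f : hom X Y) : (- g) \c f = - (g \c f).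
Proof. exact: (raddfN (precomp Z f)). Qed.
Lemma compNr X Y Z (g : hom Y Z) (f : hom X Y) : g \c (- f) = - (g \c f).
Proof. exact: (raddfN (postcomp X g)). Qed.
Lemma compDl X Y Z (g g' : hom Y Z) (f : hom X Y) :
  (g + g') \c f = g \c f + g' \c f.
Proof. exact: (raddfD (precomp Z f)). Qed.
Lemma compDr X Y Z (g : hom Y Z) (f f' : hom X Y) :
  g \c (f + f') = g \c f + g \c f'.
Proof. exact: (raddfD (postcomp X g)). Qed.
Lemma compBl X Y Z (g g' : hom Y Z) (f : hom X Y) :
  (g - g') \c f = g \c f - g' \c f.
Proof. exact: (raddfB (precomp Z f)). Qed.
Lemma compBr X Y Z (g : hom Y Z) (f f' : hom X Y) :
  g \c (f - f') = g \c f - g \c f'.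
Proof. exact: (raddfB (postcomp X g)). Qed.
Lemma compZr X Y Z k (g : hom Y Z) (f : hom X Y) :
  g \c (k *: f) = k *: (g \c f).
Proof. exact: (linearZZ (postcomp X g)). Qed.
Lemma comp_suml X Y Z n (g : 'I_n -> hom Y Z) (f : hom X Y) :
  (\sum_k g k) \c f = \sum_k (g k \c f).
Proof. exact: (raddf_sum (precomp Z f)). Qed.
Lemma comp_sumr X Y Z n (g : hom Y Z) (f : 'I_n -> hom X Y) :
  g \c (\sum_k f k) = \sum_k (g \c f k).
Proof. exact: (raddf_sum (postcomp X g)). Qed.

Lemma is_iso_id X : is_iso (idm X).
Proof. by exists (idm X); rewrite !comp_idl. Qed.

Lemma is_iso_inverses X Y (f : hom X Y) (l r : hom Y X) :
  l \c f = idm X -> f \c r = idm Y -> is_iso f.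
Proof.
move=> lf fr; exists r; split=> //.
suff -> : r = l by [].
by rewrite -[r]comp_idl -lf -comp_assoc fr comp_idr.
Qed.

Lemma isomorphic_sym X Y : isomorphic X Y -> isomorphic Y X.
Proof. by move=> [f [g [gf fg]]]; exists g, f. Qed.

Lemma isomorphic_trans Y X Z :
  isomorphic X Y -> isomorphic Y Z -> isomorphic X Z.
Proof.
move=> [f [f' [f'f ff']]] [g [g' [g'g gg']]]; exists (g \c f), (f' \c g').
split; first by rewrite comp_assoc -(comp_assoc f') g'g comp_idr.
by rewrite comp_assoc -(comp_assoc g) ff' comp_idr.
Qed.

(** The property of the objects of add T used below: the identity factors through
    a finite power of [T].  It is stated without that power, so that natural
    constructions on [T] extend to [X] by explicit sums. *)
Definition retract_of_sum T X : Prop :=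
  exists (n : nat) (a : 'I_n -> hom X T) (b : 'I_n -> hom T X),
    \sum_k b k \c a k = idm X.

Lemma in_add_retract T X : in_add T X -> retract_of_sum T X.
Proof.
move=> [n [Y [YT [inj [prj [_ _ injprj]]]]]].
have Y_retract k : exists ir : hom (Y k) T * hom T (Y k), ir.2 \c ir.1 = idm (Y k).
  have [Z [i [r [ri _ _]]]] := YT k.
  by exists (i ord0, r ord0); apply: (ri ord0).
pose ir k := sval (cid (Y_retract k)); have irE k := svalP (cid (Y_retract k)).
exists n, (fun k => (ir k).1 \c prj k), (fun k => inj k \c (ir k).2).
rewrite -injprj; apply: eq_bigr => k _.
by rewrite -comp_assoc [_ \c (_ \c prj k)]comp_assoc irE comp_idl.
Qed.

Lemma direct_sum_retract T n X :
  is_direct_sum (fun _ : 'I_n => T) X -> retract_of_sum T X.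
Proof. by move=> [inj [prj [_ _ injprj]]]; exists n, prj, inj. Qed.

Lemma retract_of_self T : retract_of_sum T T.
Proof.
exists 1%N, (fun=> idm T), (fun=> idm T).
by rewrite big_ord_recl big_ord0 addr0 comp_idl.
Qed.

Lemma retract_source0 T X W (f : hom X W) : retract_of_sum T X ->
  (forall x : hom T X, f \c x = 0) -> f = 0.
Proof.
move=> [n [a [b ba]]] f0; rewrite -[f]comp_idr -ba comp_sumr big1 // => k _.
by rewrite comp_assoc f0 comp0l.
Qed.

Lemma retract_target0 T X W (f : hom W X) : retract_of_sum T X ->
  (forall x : hom X T, x \c f = 0) -> f = 0.
Proof.
move=> [n [a [b ba]]] f0; rewrite -[f]comp_idl -ba comp_suml big1 // => k _.
by rewrite -comp_assoc f0 comp0r.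
Qed.

End LinearCategoryTheory.

(** * Triangulated categories *)

Section TriangulatedTheory.
Local Open Scope ring_scope.
Variables (K : fieldType) (C : triangulated_category K).
Implicit Types W X Y Z T : C.
Local Notation S := (susp C).
Local Notation "''S' f" := (fmap (susp C) f) (at level 9, f at level 9).

Lemma susp_full X Y (g : hom (S X) (S Y)) : exists f, 'S f = g.
Proof. by have [s _ sK] := (susp_equiv C).1 X Y; exists (s g). Qed.

Lemma susp_inj X Y : injective (@fmap _ _ _ S X Y).
Proof. exact: bij_inj ((susp_equiv C).1 X Y). Qed.

Lemma susp_sum X Y n (f : 'I_n -> hom X Y) : 'S (\sum_k f k) = \sum_k 'S (f k).
Proof. exact: raddf_sum. Qed.

Lemma susp_iso X Y (f : hom X Y) : is_iso f -> is_iso ('S f).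
Proof.
move=> [g [gf fg]]; exists ('S g).
by rewrite -!fmap_comp gf fg !fmap_id.
Qed.

Lemma susp_dense X : exists Y, isomorphic (S Y) X.
Proof. exact: (susp_equiv C).2. Qed.

Lemma susp2_dense X : exists Y, isomorphic X (S (S Y)).
Proof.
have [Y [f fi]] := susp_dense X; have [Z [g gi]] := susp_dense Y.
exists Z; apply: isomorphic_sym; apply: (@isomorphic_trans _ _ (S Y)).
  by exists ('S g); apply: susp_iso.
by exists f.
Qed.

Lemma zero_object_exists : exists Z : C, is_zero_object Z.
Proof.
have X : 'I_0 -> C by case.
have [Z [inj [prj [_ _ injprj]]]] := tri_additive X.
by exists Z; rewrite /is_zero_object -injprj big_ord0.
Qed.

Lemma zero_object_susp Z : is_zero_object Z -> is_zero_object (S Z).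
Proof. by rewrite /is_zero_object -fmap_id => ->; rewrite raddf0. Qed.

(** Exactness of Hom(W, -): [f] and the zero map form the start of a morphism from
    the rotated triangle of [idm W] to the rotation of the given one; the third
    component is a suspension by fullness. *)
Lemma triangle_lift W X Y Z (u : hom X Y) (v : hom Y Z) (w : hom Z (S X))
    (f : hom W Y) :
  distinguished u v w -> v \c f = 0 -> exists g, f = u \c g.
Proof.
move=> uvw vf0; have [O O0] := zero_object_exists.
have id_tri : distinguished (0 : hom W O) (0 : hom O (S W)) (- 'S (idm W)).
  by apply: (TR2 _ _ _).1; apply: TR1_id.
have vw_tri := (TR2 u v w).1 uvw.
have [|h [_ hE]] := TR3 (f := f) (g := (0 : hom O Z)) id_tri vw_tri.
  by rewrite comp0l vf0.
have [g gE] := susp_full h; exists g; apply: susp_inj.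
move: hE; rewrite -gE fmap_id compNr compNl comp_idr -fmap_comp.
exact: oppr_inj.
Qed.

(** Exactness of Hom(-, W), by comparison with a triangle 0 -> W -> W. *)
Lemma triangle_extend W X Y Z (u : hom X Y) (v : hom Y Z) (w : hom Z (S X))
    (f : hom Y W) :
  distinguished u v w -> f \c u = 0 -> exists g, f = g \c v.
Proof.
move=> uvw fu0; have [O O0] := zero_object_exists.
have id_tri : distinguished (0 : hom O W) (idm W) (0 : hom W (S O)).
  apply: (TR2 _ _ _).2; rewrite raddf0 oppr0.
  exact/TR1_id/zero_object_susp.
have [|h [hE _]] := TR3 (f := (0 : hom X O)) (g := f) uvw id_tri.
  by rewrite comp0r.
by exists h; rewrite hE comp_idl.
Qed.

Lemma triangle_comp0 X Y Z (u : hom X Y) (v : hom Y Z) (w : hom Z (S X)) :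
  distinguished u v w -> v \c u = 0.
Proof.
move=> uvw; have [O O0] := zero_object_exists.
have [|h [hE _]] := TR3 (f := idm X) (g := u) (TR1_id X O0) uvw.
  by rewrite !comp_idr.
by rewrite -hE comp0r.
Qed.

Lemma triangle_susp X Y Z (u : hom X Y) (v : hom Y Z) (w : hom Z (S X)) :
  distinguished u v w -> distinguished (- 'S u) (- 'S v) (- 'S w).
Proof. by move=> uvw; do 3!apply: (TR2 _ _ _).1. Qed.

Lemma triangle_susp2 X Y Z (u : hom X Y) (v : hom Y Z) (w : hom Z (S X)) :
  distinguished u v w ->
  distinguished ('S ('S u)) ('S ('S v)) ('S ('S w)).
Proof.
by move/triangle_susp/triangle_susp; rewrite !raddfN !opprK.
Qed.

(** The cone of [f] is a suspension up to isomorphism, so rotating backwards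
    turns any morphism into the middle term of a triangle; this avoids a
    quasi-inverse of the suspension. *)
Lemma triangle_cocone X Y (f : hom X Y) :
  exists (W : C) (u : hom W X) (w : hom Y (S W)), distinguished u f w.
Proof.
have [Z [z [w fzw]]] := TR1_cone f.
have [W [g [g' [g'g gg']]]] := susp_dense Z.
have [u uE] := susp_full (- (w \c g)).
exists W, u, (g' \c z); apply: (TR2 _ _ _).2; rewrite uE opprK.
have g'_iso : is_iso g' by exists g.
apply: (TR1_iso fzw (is_iso_id _) (is_iso_id _) g'_iso).
- by rewrite comp_idl comp_idr.
- by rewrite comp_idr.
- by rewrite fmap_id comp_idl -comp_assoc gg' comp_idr.
Qed.

(** The difference [n] of [e] and the identity kills [v], hence factors through
    [w], and [w] kills [n]; so [n] has square zero and [e] is unipotent. *)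
Lemma triangle_end_unipotent X Y Z (u : hom X Y) (v : hom Y Z)
    (w : hom Z (S X)) (e : hom Z Z) :
  distinguished u v w -> e \c v = v -> w \c e = w ->
  exists e', e' \c e = idm Z /\ e \c e' = idm Z.
Proof.
move=> uvw ev we; have [n nE] : exists n, n = e - idm Z by exists (e - idm Z).
have eE : e = idm Z + n by rewrite nE addrC subrK.
have nv0 : n \c v = 0 by rewrite nE compBl ev comp_idl subrr.
have wn0 : w \c n = 0 by rewrite nE compBr we comp_idr subrr.
have [n' n'E] := triangle_extend ((TR2 _ _ _).1 uvw) nv0.
have nn0 : n \c n = 0 by rewrite {1}n'E -comp_assoc wn0 comp0r.
exists (idm Z - n); rewrite eE compBl compBr !compDr !compDl nn0.
by rewrite !comp_idl !comp_idr !addr0 addrK.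
Qed.

(** Lifting both [f, g] and their inverses gives maps between the cones whose two
    composites are unipotent. *)
Lemma triangle_iso X Y Z X' Y' Z' (u : hom X Y) (v : hom Y Z) (w : hom Z (S X))
    (u' : hom X' Y') (v' : hom Y' Z') (w' : hom Z' (S X'))
    (f : hom X X') (g : hom Y Y') :
  distinguished u v w -> distinguished u' v' w' -> is_iso f -> is_iso g ->
  g \c u = u' \c f -> isomorphic Z Z'.
Proof.
move=> uvw uvw' [f' [f'f ff']] [g' [g'g gg']] gu.
have gu' : g' \c u' = u \c f'.
  by rewrite -[u']comp_idr -ff' (comp_assoc u') -gu !comp_assoc g'g comp_idl.
have [h [hv hw]] := TR3 uvw uvw' gu.
have [h' [hv' hw']] := TR3 uvw' uvw gu'.
have [||e [eh _]] := triangle_end_unipotent (e := h' \c h) uvw.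
- by rewrite -comp_assoc hv comp_assoc hv' -comp_assoc g'g comp_idr.
- by rewrite comp_assoc -hw' -comp_assoc -hw comp_assoc -fmap_comp f'f fmap_id
             comp_idl.
have [||e' [_ he]] := triangle_end_unipotent (e := h \c h') uvw'.
- by rewrite -comp_assoc hv' comp_assoc hv -comp_assoc gg' comp_idr.
- by rewrite comp_assoc -hw -comp_assoc -hw' comp_assoc -fmap_comp ff' fmap_id
             comp_idl.
exists h; apply: (is_iso_inverses (l := e \c h') (r := h' \c e')).
  by rewrite -comp_assoc.
by rewrite comp_assoc.
Qed.

End TriangulatedTheory.

(** * Duality over a field and symmetrizing forms *)

Section Duality.
Local Open Scope ring_scope.
Variable K : fieldType.

Lemma functional_separates (V : vectType K) (v : V) :
  (forall f : 'Hom(V, K^o), f v = 0) -> v = 0.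
Proof.
move=> fv0; rewrite (coord_vbasis (memvf v)) big1 // => i _.
have := fv0 (linfun (coord (vbasis fullv) i : V -> K^o)); rewrite lfunE /= => ->.
by rewrite scale0r.
Qed.

(** If [W] is the dual of [V], then [V] is the dual of [W]: the vector that
    represents [l] is read off from the values of [l] on the dual basis. *)
Lemma dual_reflexive (V W : vectType K) (B : {linear W -> 'Hom(V, K^o)}) :
  bijective B -> forall l : 'Hom(W, K^o), exists v, forall w, B w v = l w.
Proof.
move=> [B' BK B'K] l; pose e := vbasis (@fullv K V).
pose v := \sum_(i < \dim {:V}) l (B' (linfun (coord e i : V -> K^o))) *: e`_i.
exists v => w; rewrite /v linear_sum /=.
have Bw : w = \sum_(i < \dim {:V}) B w e`_i *: B' (linfun (coord e i : V -> K^o)).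
  apply: (can_inj BK); apply/lfunP => x; rewrite linear_sum sum_lfunE.
  rewrite [in LHS](coord_vbasis (memvf x)) linear_sum; apply: eq_bigr => i _.
  rewrite linearZ linearZ /= B'K scale_lfunE lfunE /=.
  exact: mulrC.
rewrite [in RHS]Bw linear_sum; apply: eq_bigr => i _.
rewrite !linearZ /=; exact: mulrC.
Qed.

(** The form is the functional that corresponds to 1 under the bimodule
    isomorphism; compatibility with left and right multiplication by the same
    element gives its symmetry. *)
Lemma symmetrizing_form (A : fdAlgType K) : symmetric_algebra A ->
  exists tau : 'Hom(A, K^o),
    [/\ forall x y : A, tau (x * y) = tau (y * x),
        forall x : A, (forall y : A, tau (x * y) = 0) -> x = 0 &
        forall l : 'Hom(A, K^o), exists a : A, forall y : A, l y = tau (a * y)].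
Proof.
move=> [Phi [[Psi PhiK PsiK] PhiE]]; exists (Phi 1).
have Phir (a y : A) : Phi a y = Phi 1 (y * a).
  by have := PhiE a 1 1 y; rewrite !mulr1 mul1r.
have Phil (a y : A) : Phi a y = Phi 1 (a * y).
  by have := PhiE 1 1 a y; rewrite !mulr1 mul1r.
split=> [x y|x x0|l]; first by rewrite -Phir -Phil.
  apply: (can_inj PhiK); rewrite raddf0; apply/lfunP => y.
  by rewrite Phil x0 lfunE.
by exists (Psi l) => y; rewrite -Phil PsiK.
Qed.

End Duality.

(** * Approximations by a cluster-tilting object *)

Section ClusterTilting.
Local Open Scope ring_scope.
Variables (K : fieldType) (C : triangulated_category K) (T : C).
Hypothesis T_ct : cluster_tilting T.
Implicit Types W X Y Z : C.
Local Notation S := (susp C).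
Local Notation "''S' f" := (fmap (susp C) f) (at level 9, f at level 9).

Lemma retract_susp0 X Y (f : hom X (S Y)) :
  retract_of_sum T X -> retract_of_sum T Y -> f = 0.
Proof.
move=> TX [n [a [b ba]]]; apply: (retract_source0 TX) => x.
rewrite -[f]comp_idl -fmap_id -ba susp_sum !comp_suml; apply: big1 => k _.
by rewrite fmap_comp -!comp_assoc (T_ct.1 ('S (a k) \c _)) comp0r.
Qed.

Lemma tilting_object_retract X :
  (forall f : hom T (S X), f = 0) -> retract_of_sum T X.
Proof. by move=> /T_ct.2/in_add_retract. Qed.

(** [T0] is a power of [T] indexed by a basis of Hom(T, X), so every map from [T]
    to [X] factors through [v].  Then no nonzero map goes from [T] to the
    suspension of [T1], which puts [T1] in add T. *)
Lemma approximation X : exists (T1 T0 : C) (u : hom T1 T0) (v : hom T0 X) w,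
  [/\ retract_of_sum T T1, retract_of_sum T T0 & distinguished u v w].
Proof.
pose e := vbasis (@fullv K (hom T X)).
have [T0 sumT0] := tri_additive (fun i : 'I_(\dim {:hom T X}) => T).
have TT0 := direct_sum_retract sumT0.
have [inj [prj [prj_inj prj_inj0 _]]] := sumT0.
pose v : hom T0 X := \sum_(k < \dim {:hom T X}) e`_k \c prj k.
have v_inj k : v \c inj k = e`_k.
  rewrite comp_suml (bigD1 k) //= -comp_assoc prj_inj comp_idr big1 ?addr0 //.
  by move=> l lk; rewrite -comp_assoc prj_inj0 // comp0r.
have v_approx (f : hom T X) : exists g, f = v \c g.
  exists (\sum_(k < \dim {:hom T X}) coord e k f *: inj k); rewrite comp_sumr.
  rewrite [LHS](coord_vbasis (memvf f)); apply: eq_bigr => k _.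
  by rewrite compZr v_inj.
have [T1 [u [z uvz]]] := triangle_cocone v; exists T1, T0, u, v, z; split=> //.
apply: tilting_object_retract => f.
have [f' ->] := triangle_lift ((TR2 _ _ _).1 ((TR2 _ _ _).1 uvz))
  (retract_susp0 (- 'S u \c f) (retract_of_self T) TT0).
have [f'' ->] := v_approx f'.
by rewrite comp_assoc (triangle_comp0 ((TR2 _ _ _).1 uvz)) comp0l.
Qed.

(** The triangle of an approximation of [S Y], rotated so that it starts at [Y]:
    applying [Hom(T, -)] to it relates [Hom(T, S Y)] and [Hom(T, Y)]. *)
Record tilting_resolution (Y : C) := TiltingResolution {
  tr1 : C; tr0 : C;
  tr_y : hom Y tr1; tr_u : hom tr1 tr0; tr_v : hom tr0 (S Y);
  tr1_retract : retract_of_sum T tr1;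
  tr0_retract : retract_of_sum T tr0;
  tr_triangle : distinguished tr_y tr_u tr_v
}.

Lemma tilting_resolution_exists Y : inhabited (tilting_resolution Y).
Proof.
have [T1 [T0 [u [v [w [TT1 TT0 uvw]]]]]] := approximation (S Y).
have [y yE] := susp_full (- w).
by exists; exists T1 T0 y u v => //; apply: (TR2 _ _ _).2; rewrite yE opprK.
Qed.

End ClusterTilting.

(** * The square of the suspension *)

Section SymmetricTwist.
Local Open Scope ring_scope.
Variables (K : fieldType) (C : triangulated_category K) (T : C).
Variable Lambda : fdAlgType K.
Hypotheses (Lambda_sym : symmetric_algebra Lambda)
  (cy : calabi_yau2 C) (T_ct : cluster_tilting T)
  (Lambda_End : isomorphic_to_End Lambda T).
Local Notation S := (susp C).
Local Notation "''S' f" := (fmap (susp C) f) (at level 9, f at level 9).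

Lemma End_form : exists tau : 'Hom(hom T T, K^o),
    [/\ forall f g : hom T T, tau (f \c g) = tau (g \c f),
        forall f : hom T T, (forall g : hom T T, tau (g \c f) = 0) -> f = 0 &
        forall l : 'Hom(hom T T, K^o), exists a : hom T T,
          forall f : hom T T, l f = tau (a \c f)].
Proof.
have [phi [[psi phiK psiK] phi1 phiM]] := Lambda_End.
have [tau [tauC tau_nd tau_rep]] := symmetrizing_form Lambda_sym.
have psi_lin : linear psi.
  by move=> k x y; apply: (can_inj phiK); rewrite linearP !psiK.
pose psil : {linear hom T T -> Lambda} :=
  HB.pack psi (GRing.isLinear.Build _ _ _ _ _ psi_lin).
have psiM f g : psi (f \c g) = psi f * psi g.
  by apply: (can_inj phiK); rewrite phiM !psiK.
exists (linfun (tau \o psil)).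
have tauE f : linfun (tau \o psil) f = tau (psi f) by rewrite lfunE.
split=> [f g|f f0|l]; first by rewrite !tauE !psiM tauC.
  suff p0 : psi f = 0 by rewrite -[f]psiK p0 raddf0.
  apply: tau_nd => y; rewrite tauC -[y]phiK -psiM -tauE; exact: f0.
have [a aE] := tau_rep (linfun (l \o phi)).
exists (phi a) => f; rewrite tauE psiM phiK -aE lfunE /= psiK //.
Qed.

(** [eta] is the vector that represents the symmetrizing form under the
    Calabi-Yau duality; naturality of the duality in its two arguments turns the
    symmetry of the form into the commutation of [eta] with endomorphisms. *)
Lemma twist_exists : exists eta : hom T (S (S T)),
  [/\ forall a : hom T T, 'S ('S a) \c eta = eta \c a,
      forall a : hom T T, eta \c a = 0 -> a = 0 &
      forall g : hom T (S (S T)), exists a, g = eta \c a].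
Proof.
have [phi [phi_bij phi_nat]] := cy.
have [tau [tauC tau_nd tau_rep]] := End_form.
have [eta etaE] := dual_reflexive (phi_bij T T) tau.
have natl (a f : hom T T) g : phi T T f ('S ('S a) \c g) = phi T T (f \c a) g.
  by have := phi_nat T T T T a (idm T) f g; rewrite comp_idl comp_idr => ->.
have natr (a f : hom T T) g : phi T T f (g \c a) = phi T T (a \c f) g.
  have := phi_nat T T T T (idm T) a f g.
  by rewrite !fmap_id comp_idl comp_idr => ->.
have phi_sep g : (forall f : hom T T, phi T T f g = 0) -> g = 0.
  move=> g0; apply: functional_separates => l.
  by have [psi _ psiK] := phi_bij T T; rewrite -(psiK l) g0.
exists eta; split=> [a|a a0|g].
- apply/eqP; rewrite -subr_eq0; apply/eqP/phi_sep => f.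
  by rewrite raddfB /= natl natr !etaE tauC subrr.
- apply: tau_nd => f; rewrite tauC -etaE -natr a0; exact: raddf0.
have l_lin : linear (fun f : hom T T => phi T T f g : K^o).
  by move=> k x y; rewrite linearP lfunE /= lfunE.
pose l : {linear hom T T -> K^o} := HB.pack (fun f : hom T T => phi T T f g : K^o)
  (GRing.isLinear.Build _ _ _ _ _ l_lin).
have [a aE] := tau_rep (linfun l); exists a.
apply/eqP; rewrite -subr_eq0; apply/eqP/phi_sep => f.
rewrite raddfB /= natr etaE -aE lfunE /=; exact: subrr.
Qed.

(** In a triangle Y -> T -> S^2 T -> S Y over [eta], bijectivity of composition
    with [eta] puts [Y] in add T and forces Y -> T to vanish.  Then S Y is a
    retract of S^2 T, which is impossible unless S Y = 0, as there are no nonzero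
    maps from Y to S T. *)
Lemma twist_iso_exists : exists eta : hom T (S (S T)),
  is_iso eta /\ forall a : hom T T, 'S ('S a) \c eta = eta \c a.
Proof.
have [eta [eta_nat eta_inj eta_surj]] := twist_exists.
exists eta; split=> //.
have [Y [y [z yez]]] := triangle_cocone eta.
have TY : retract_of_sum T Y.
  apply: tilting_object_retract => // f.
  have [|f' ->] := triangle_lift ((TR2 _ _ _).1 ((TR2 _ _ _).1 yez)) (f := f).
    by apply: (retract_susp0 T_ct); apply: retract_of_self.
  have [a ->] := eta_surj f'.
  by rewrite comp_assoc (triangle_comp0 ((TR2 _ _ _).1 yez)) comp0l.
have y0 : y = 0.
  apply: (retract_source0 TY) => x; apply: eta_inj.
  by rewrite comp_assoc (triangle_comp0 yez) comp0l.
have [|s sE] := triangle_lift ((TR2 _ _ _).1 ((TR2 _ _ _).1 yez)) (f := idm (S Y)).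
  by rewrite y0 raddf0 oppr0 comp0l.
have s0 : s = 0.
  have [s' <-] := susp_full s.
  by rewrite (retract_susp0 T_ct s' TY (retract_of_self T)) raddf0.
have SY0 : is_zero_object (S Y) by rewrite /is_zero_object sE s0 comp0r.
have [|r rE] := triangle_lift ((TR2 _ _ _).1 yez) (f := idm (S (S T))).
  by rewrite comp_idr -[z]comp_idl SY0 comp0l.
apply: (is_iso_inverses (l := r) (r := r)) => //.
apply/eqP; rewrite -subr_eq0; apply/eqP/eta_inj.
by rewrite compBr comp_assoc -rE comp_idl comp_idr subrr.
Qed.

Section Twist.
Variable eta : hom T (S (S T)).
Hypotheses (eta_iso : is_iso eta)
  (eta_nat : forall a : hom T T, 'S ('S a) \c eta = eta \c a).

(** Transport [eta] along factorizations of identities through powers of [T]. *)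
Lemma twist_retract : exists theta : forall X : C, hom X (S (S X)),
  (forall X, retract_of_sum T X -> is_iso (theta X)) /\
  (forall X Y (f : hom X Y), retract_of_sum T X -> retract_of_sum T Y ->
     'S ('S f) \c theta X = theta Y \c f).
Proof.
have [eta' [eta'K etaK]] := eta_iso.
have nat' a : eta' \c 'S ('S a) = a \c eta'.
  rewrite -[_ \c 'S _]comp_idr -etaK comp_assoc -(comp_assoc eta') eta_nat.
  by rewrite comp_assoc eta'K comp_idl.
(* [th.2] is the inverse of [th.1] when [X] is in add T; elsewhere both are arbitrary. *)
pose D X (th : hom X (S (S X)) * hom (S (S X)) X) :=
  exists (n : nat) (a : 'I_n -> hom X T) (b : 'I_n -> hom T X),
   [/\ \sum_k b k \c a k = idm X,
       th.1 = \sum_k 'S ('S (b k)) \c eta \c a k &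
       th.2 = \sum_k b k \c eta' \c 'S ('S (a k))].
have D_ex X : exists th, retract_of_sum T X -> D X th.
  have [[n [a [b ba]]]|nX] := pselect (retract_of_sum T X); last first.
    by exists (0, 0).
  by eexists (_, _) => _; exists n, a, b.
pose th X := sval (cid (D_ex X)).
have thE X TX : D X (th X) := svalP (cid (D_ex X)) TX.
exists (fun X => (th X).1); split=> [X TX|X Y f TX TY].
  have [n [a [b [ba th1 th2]]]] := thE X TX.
  apply: (is_iso_inverses (l := (th X).2) (r := (th X).2)).
    rewrite th1 th2 comp_suml -ba.
    transitivity (\sum_k \sum_l b k \c (a k \c b l) \c a l).
      apply: eq_bigr => k _; rewrite comp_sumr; apply: eq_bigr => l _.
      rewrite !comp_assoc -[_ \c _ \c _ \c 'S _]comp_assoc -!fmap_comp.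
      by rewrite -(comp_assoc (b k)) nat' -!comp_assoc (comp_assoc eta') eta'K
                 comp_idl.
    apply: eq_bigr => k _.
    under eq_bigr do rewrite -2!comp_assoc.
    by rewrite -!comp_sumr ba comp_idr.
  rewrite th1 th2 comp_suml -fmap_id -fmap_id -ba.
  have -> : 'S ('S (\sum_k b k \c a k)) = \sum_k 'S ('S (b k \c a k)).
    by rewrite !susp_sum.
  apply: eq_bigr => k _; rewrite comp_sumr.
  under eq_bigr => l _.
    rewrite -!comp_assoc (comp_assoc (a k)) (comp_assoc _ eta') -nat'.
    rewrite -!comp_assoc -!fmap_comp (comp_assoc eta) etaK comp_idl.
    rewrite -!fmap_comp.
    over.
  rewrite -!susp_sum.
  have -> : \sum_l b k \c (a k \c b l \c a l) = b k \c a k.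
    rewrite -comp_sumr; under eq_bigr do rewrite -comp_assoc.
    by rewrite -comp_sumr ba comp_idr.
  by [].
have [n [a [b [ba -> _]]]] := thE X TX.
have [m [c [d [dc -> _]]]] := thE Y TY.
rewrite comp_sumr comp_suml.
transitivity (\sum_k \sum_l 'S ('S (d l)) \c eta \c (c l \c f \c b k \c a k)).
  apply: eq_bigr => k _.
  rewrite !comp_assoc -!fmap_comp -[f \c b k]comp_idl -dc comp_suml.
  rewrite !susp_sum !comp_suml; apply: eq_bigr => l _.
  rewrite -!comp_assoc !fmap_comp -!comp_assoc.
  congr (_ \c _).
  by rewrite !comp_assoc -!fmap_comp eta_nat -!comp_assoc.
rewrite exchange_big; apply: eq_bigr => l _ /=.
rewrite -comp_sumr; under eq_bigr do rewrite -comp_assoc.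
by rewrite -comp_sumr ba comp_idr -!comp_assoc.
Qed.

(** Both objects are cones of isomorphic maps between objects of add T. *)
Lemma susp2_object X : isomorphic (S (S X)) X.
Proof.
apply: isomorphic_sym.
have [T1 [T0 [u [v [w [TT1 TT0 uvw]]]]]] := approximation T_ct X.
have [theta [theta_iso theta_nat]] := twist_retract.
apply: (triangle_iso uvw (triangle_susp2 uvw) (theta_iso _ TT1)
  (theta_iso _ TT0)).
by rewrite theta_nat.
Qed.

(** Composing with [eta] identifies the maps from S T to T with those from S T to
    S^2 T, that is, with Hom(T, S T) = 0. *)
Lemma susp_no_hom X (g : hom (S T) X) : retract_of_sum T X -> g = 0.
Proof.
move=> TX; apply: (retract_target0 TX) => a.
have [eta' [eta'K etaK]] := eta_iso.
rewrite -[_ \c g]comp_idl -eta'K -comp_assoc.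
have [f <-] := susp_full (eta \c (a \c g)).
by rewrite (T_ct.1 f) raddf0 comp0r.
Qed.

End Twist.
End SymmetricTwist.

(** * The functor Hom(T, -) to modules *)

Section Quotients.
Local Open Scope ring_scope.

Lemma same_kernel_iso (R : pzRingType) (A M N : lmodType R)
    (q : {linear A -> M}) (r : {linear A -> N}) :
  (forall y, exists x, q x = y) -> (forall y, exists x, r x = y) ->
  (forall x, q x = 0 <-> r x = 0) ->
  exists (f : {linear M -> N}) (g : {linear N -> M}), cancel f g /\ cancel g f.
Proof.
move=> q_surj r_surj qr; pose s y := sval (cid (q_surj y)).
have sK y : q (s y) = y by rewrite /s; case: cid.
have rsq x : r (s (q x)) = r x.
  by apply/eqP; rewrite -subr_eq0 -raddfB; apply/eqP/qr; rewrite raddfB /= sK subrr.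
have f_lin : linear (r \o s).
  move=> k x y /=; rewrite -[in LHS](sK x) -[in LHS](sK y) -linearP rsq.
  exact: linearP.
pose f : {linear M -> N} := HB.pack (r \o s) (GRing.isLinear.Build _ _ _ _ _ f_lin).
exists f; apply: linear_bijection_inverse.
  move=> x y /= /eqP; rewrite -subr_eq0 -raddfB => /eqP/qr.
  by rewrite raddfB /= !sK => /eqP; rewrite subr_eq0 => /eqP.
by move=> y; have [x <-] := r_surj y; exists (q x); exact: rsq.
Qed.

(** A subspace of maximal dimension contained in [P] exhausts [P], since any
    further vector of [P] could be adjoined to it. *)
Lemma subspace_vspace (K : fieldType) (V : vectType K) (P : V -> Prop) :
  P 0 -> (forall k x y, P x -> P y -> P (k *: x + y)) ->
  exists U : {vspace V}, forall x, x \in U <-> P x.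
Proof.
move=> P0 PD.
pose D n := `[< exists U : {vspace V}, \dim U = n /\ forall x, x \in U -> P x >].
have D_ex : exists n, D n.
  exists 0%N; apply/asboolP; exists 0%VS; split; first by rewrite dimv0.
  by move=> x; rewrite memv0 => /eqP ->.
have D_le n : D n -> (n <= \dim {:V})%N.
  by move=> /asboolP[U [<- _]]; apply/dimvS/subvf.
case: (ex_maxnP D_ex D_le) => n /asboolP[U [dimU UP]] n_max.
exists U => x; split=> [|Px]; first exact: UP.
have : D (\dim (U + <[x]>)).
  apply/asboolP; exists (U + <[x]>)%VS; split=> // y.
  case/memv_addP=> u uU [z /vlineP[k ->] ->].
  by rewrite addrC; apply: PD => //; apply: UP.
move=> /n_max; rewrite -dimU => le_dim.
have : (U == U + <[x]>)%VS by rewrite eqEdim addvSl.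
by move=> /eqP ->; apply: (subvP (addvSr _ _)); apply: memv_line.
Qed.

End Quotients.

Section HomModules.
Local Open Scope ring_scope.
Variables (K : fieldType) (C : triangulated_category K) (T : C).
Hypothesis T_ct : cluster_tilting T.
Variables (Lambda : fdAlgType K) (phi : {linear Lambda -> hom T T}).
Hypotheses (phi_bij : bijective phi) (phi1 : phi 1 = idm T)
  (phiM : forall x y : Lambda, phi (x * y) = phi x \c phi y).
Implicit Types W X Y Z : C.
Local Notation S := (susp C).
Local Notation "''S' f" := (fmap (susp C) f) (at level 9, f at level 9).
Local Notation Lc := ((alg_sort Lambda)^c).

Lemma hom_scaleA X (a b : Lc) (x : hom T X) :
  (x \c phi b) \c phi a = x \c phi (a * b).
Proof. by rewrite -comp_assoc -phiM. Qed.
Lemma hom_scale1 X (x : hom T X) : x \c phi 1 = x.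
Proof. by rewrite phi1 comp_idr. Qed.
Lemma hom_scaleDr X (a : Lc) : {morph (fun x : hom T X => x \c phi a) : x y / x + y}.
Proof. by move=> x y; rewrite compDl. Qed.
Lemma hom_scaleDl X (x : hom T X) : {morph (fun a : Lc => x \c phi a) : a b / a + b}.
Proof. by move=> a b; rewrite raddfD compDr. Qed.

(** Right multiplication by [phi a] is an action of the converse ring, because
    [phi] turns products into composites in the same order. *)
Definition hom_lmodule X : lmodType Lc :=
  HB.pack (GRing.Zmodule.sort (hom T X)) (GRing.Zmodule_isLmodule.Build Lc (hom T X)
    (@hom_scaleA X) (@hom_scale1 X) (@hom_scaleDr X) (@hom_scaleDl X)).

Lemma phi_scalar (k : K) : phi (k *: (1 : Lambda)) = k *: idm T.
Proof. by rewrite linearZ /= phi1. Qed.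

Lemma hom_fg X : finitely_generated (hom_lmodule X).
Proof.
pose e := vbasis (@fullv K (hom T X)).
exists (\dim {:hom T X}), (fun i => e`_i) => x.
exists (fun i => (coord e i x) *: (1 : Lambda)).
rewrite [LHS](coord_vbasis (memvf (x : hom T X))).
apply: eq_bigr => i _.
transitivity (e`_i \c phi (coord e i x *: (1 : Lambda))) => //.
by rewrite phi_scalar compZr comp_idr.
Qed.

Definition hom_module X : right_fgmod Lambda := FgMod (hom_fg X).

Lemma hom_map_linear X Y (f : hom X Y) :
  linear ((fun x => f \c x) : hom_module X -> hom_module Y).
Proof.
move=> a x y; transitivity (f \c (x \c phi a + y)) => //.
by rewrite compDr comp_assoc.
Qed.

Definition hom_map X Y (f : hom X Y) : {linear hom_module X -> hom_module Y} :=
  HB.pack ((fun x => f \c x) : hom_module X -> hom_module Y)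
   (GRing.isLinear.Build _ _ _ _ _ (hom_map_linear f)).

Lemma hom_projective X : retract_of_sum T X -> projective (hom_module X).
Proof.
move=> [n [a [b ba]]] M N g f g_surj.
have [psi phiK psiK] := phi_bij.
have [m mE] := choice (fun k => g_surj (f (b k))).
pose h (x : hom_module X) := \sum_k (psi (a k \c x) : Lc) *: m k.
have psi_lin c x y : psi (x \c phi c + y) = psi x * c + psi y.
  by apply: (can_inj phiK); rewrite linearD /= phiM !psiK.
have h_lin : linear h.
  move=> c x y; rewrite /h scaler_sumr -big_split; apply: eq_bigr => k _ /=.
  rewrite scalerA -scalerDl; congr (_ *: _).
  transitivity (psi (a k \c (x \c phi c + y))) => //.
  by rewrite compDr comp_assoc psi_lin.
pose hl : {linear hom_module X -> M} :=
  HB.pack h (GRing.isLinear.Build _ _ _ _ _ h_lin).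
exists hl => x; transitivity (g (h x)) => //; rewrite /h linear_sum /=.
transitivity (f (\sum_k (psi (a k \c x) : Lc) *: (b k : hom_module X))).
  by rewrite linear_sum; apply: eq_bigr => k _; rewrite !linearZ /= mE.
congr (f _); transitivity ((\sum_k b k \c a k) \c x); last by rewrite ba comp_idl.
rewrite comp_suml; apply: eq_bigr => k _.
transitivity (b k \c phi (psi (a k \c x))) => //.
by rewrite psiK comp_assoc.
Qed.

(** Extend [g] from the maps T -> X to a map [p] out of the approximation [T0] of
    [X]; it vanishes on [T1], hence descends to [X]. *)
Lemma hom_full X Y (g : {linear hom_module X -> hom_module Y}) :
  exists f : hom X Y, forall x : hom T X, g x = f \c x.
Proof.
have [T1 [T0 [u [v [w [TT1 [n [a [b ba]]] uvw]]]]]] := approximation T_ct X.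
have [psi phiK psiK] := phi_bij.
pose p : hom T0 Y := \sum_k (g (v \c b k) : hom T Y) \c a k.
have pE (x : hom T T0) : p \c x = g (v \c x).
  rewrite comp_suml; transitivity (g (\sum_k v \c b k \c (a k \c x))); last first.
    congr (g _); rewrite -{2}[x]comp_idl -ba comp_suml comp_sumr.
    by apply: eq_bigr => k _; rewrite !comp_assoc.
  rewrite linear_sum; apply: eq_bigr => k _.
  rewrite -comp_assoc -[a k \c x]psiK.
  by rewrite -[RHS]/(g ((psi (a k \c x) : Lc) *: (v \c b k : hom_module X))) linearZ.
have [f fE] : exists f, p = f \c v.
  apply: (triangle_extend uvw); apply: (retract_source0 TT1) => x.
  rewrite -comp_assoc pE comp_assoc (triangle_comp0 uvw) comp0l.
  exact: (raddf0 g).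
exists f => x.
have [x' ->] := triangle_lift ((TR2 _ _ _).1 uvw)
  (retract_susp0 T_ct (w \c x) (retract_of_self T) TT1).
by rewrite comp_assoc -fE pE.
Qed.

(** [X] is the cone of a presentation of [M]: [T0] is a power of [T] indexed by
    generators, and [T1] one indexed by a basis of the module of relations. *)
Lemma hom_dense (M : right_fgmod Lambda) :
  exists X (f : {linear M -> hom_module X}) (g : {linear hom_module X -> M}),
    cancel f g /\ cancel g f.
Proof.
have [psi phiK psiK] := phi_bij.
have psi_lin c x y : psi (x \c phi c + y) = psi x * c + psi y.
  by apply: (can_inj phiK); rewrite linearD /= phiM !psiK.
have [n [m mE]] := fgmod_fg M.
have [T0 [inj [prj [prj_inj prj_inj0 injprj]]]] :=
  tri_additive (fun _ : 'I_n => T).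
pose q (x : hom_module T0) := \sum_i (psi (prj i \c x) : Lc) *: m i.
have q_lin : linear q.
  move=> c x y; rewrite /q scaler_sumr -big_split; apply: eq_bigr => k _ /=.
  rewrite scalerA -scalerDl; congr (_ *: _).
  transitivity (psi (prj k \c (x \c phi c + y))) => //.
  by rewrite compDr comp_assoc psi_lin.
pose ql : {linear hom_module T0 -> M} :=
  HB.pack q (GRing.isLinear.Build _ _ _ _ _ q_lin).
have qZ (c : Lambda) (x : hom T T0) : q (x \c phi c) = (c : Lc) *: q x.
  by rewrite -[LHS]/(ql ((c : Lc) *: (x : hom_module T0))) linearZ.
have [U UE] : exists U : {vspace hom T T0}, forall x, x \in U <-> q x = 0.
  apply: subspace_vspace; first exact: (raddf0 ql).
  move=> k x y qx qy.
  have -> : k *: x + y = x \c phi (k *: (1 : Lambda)) + y.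
    by rewrite phi_scalar compZr comp_idr.
  rewrite -[LHS]/(ql ((k *: (1 : Lambda) : Lc) *: (x : hom_module T0) + y)) linearP.
  by rewrite -[ql x]/(q x) -[ql y]/(q y) qx qy scaler0 addr0.
pose e := vbasis U.
have [T1 sumT1] := tri_additive (fun i : 'I_(\dim U) => T).
have TT1 := direct_sum_retract sumT1.
have [inj1 [prj1 [prj_inj1 prj_inj10 _]]] := sumT1.
pose u : hom T1 T0 := \sum_(k < \dim U) e`_k \c prj1 k.
have u_inj k : u \c inj1 k = e`_k.
  rewrite comp_suml (bigD1 k) //= -comp_assoc prj_inj1 comp_idr big1 ?addr0 //.
  by move=> l lk; rewrite -comp_assoc prj_inj10 // comp0r.
have [X [v [w uvw]]] := TR1_cone u; exists X.
apply: (same_kernel_iso (q := ql) (r := hom_map v)).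
- move=> y; have [c ->] := mE y; exists (\sum_i inj i \c phi (c i)).
  apply: eq_bigr => i _; rewrite comp_sumr (bigD1 i) //= comp_assoc prj_inj.
  rewrite comp_idl big1 ?addr0 ?phiK // => l li.
  by rewrite comp_assoc prj_inj0 ?comp0l // eq_sym.
- move=> y; have [x ->] := triangle_lift ((TR2 _ _ _).1 uvw)
    (retract_susp0 T_ct (w \c y) (retract_of_self T) TT1).
  by exists x.
- move=> x; split=> [qx|vx].
    have xU : x \in U by apply/UE.
    transitivity (v \c x) => //; rewrite (coord_vbasis xU) comp_sumr.
    apply: big1 => k _.
    by rewrite compZr -u_inj comp_assoc (triangle_comp0 uvw) comp0l scaler0.
  have [y ->] := triangle_lift uvw (vx : v \c x = 0).
  rewrite /u comp_suml raddf_sum; apply: big1 => k _.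
  rewrite -comp_assoc -[prj1 k \c y]psiK; apply: etrans (qZ _ _) _.
  have -> : q e`_k = 0 by apply/UE; rewrite (vbasis_mem (mem_nth _ _)) ?size_tuple.
  exact: scaler0.
Qed.

Lemma hom_dense_susp2 (M : right_fgmod Lambda) :
  exists Z (f : {linear M -> hom_module (S (S Z))})
    (g : {linear hom_module (S (S Z)) -> M}), cancel f g /\ cancel g f.
Proof.
have [X [f [g [fK gK]]]] := hom_dense M.
have [Z [h [h' [hK h'K]]]] := susp2_dense X.
exists Z, (hom_map h \o f), (g \o hom_map h'); split=> x.
  rewrite -[RHS]fK; congr (g _).
  transitivity (h' \c (h \c f x)) => //.
  by rewrite comp_assoc hK comp_idl.
transitivity (h \c f (g (h' \c x))) => //.
by rewrite gK comp_assoc h'K comp_idl.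
Qed.

Variable eta : hom T (S (S T)).
Hypotheses (eta_iso : is_iso eta)
  (eta_nat : forall a : hom T T, 'S ('S a) \c eta = eta \c a).

(** Commutation of [eta] with End(T) is exactly linearity of x |-> S^2(x) eta;
    naturality in [X] holds by functoriality of S^2. *)
Lemma hom_susp2 : exists kappa : forall X,
    {linear hom_module X -> hom_module (S (S X))},
  (forall X (x : hom T X), kappa X x = 'S ('S x) \c eta) /\
  forall X, exists g : {linear hom_module (S (S X)) -> hom_module X},
    cancel (kappa X) g /\ cancel g (kappa X).
Proof.
pose k X (x : hom_module X) : hom_module (S (S X)) := 'S ('S x) \c eta.
have k_lin X : linear (@k X).
  move=> a x y; transitivity ('S ('S (x \c phi a + y)) \c eta) => //.
  by rewrite /k !linearD /= !fmap_comp compDl -!comp_assoc eta_nat comp_assoc.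
pose kl X : {linear hom_module X -> hom_module (S (S X))} :=
  HB.pack (@k X) (GRing.isLinear.Build _ _ _ _ _ (k_lin X)).
exists kl; split=> // X; have [eta' [eta'K etaK]] := eta_iso.
apply: linear_bijection_inverse.
  move=> x y kxy; do 2!apply: susp_inj.
  rewrite -['S ('S x)]comp_idr -['S ('S y)]comp_idr -etaK !comp_assoc.
  by congr (_ \c _).
move=> y; have [y' y'E] := susp_full (y \c eta'); have [x xE] := susp_full y'.
exists x; transitivity ('S ('S x) \c eta) => //.
by rewrite xE y'E -comp_assoc eta'K comp_idr.
Qed.

Section ResolutionTwoStep.
Variables (Y : C) (t : tilting_resolution T Y).

(** A map killed by [tr_y t] has a suspension that factors through a map from S T
    to [tr0 t]; such maps vanish because S^2 fixes [T]. *)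
Lemma resolution_inj : injective (hom_map (tr_y t)).
Proof.
have tri2 := (TR2 _ _ _).1 ((TR2 _ _ _).1 (tr_triangle t)).
move=> a b ab; apply/eqP; rewrite -subr_eq0; apply/eqP.
have yab : tr_y t \c (a - b) = 0.
  by rewrite compBr; apply/eqP; rewrite subr_eq0; apply/eqP.
apply: susp_inj; rewrite raddf0.
have [|g ->] := triangle_lift tri2 (f := 'S (a - b)).
  by rewrite compNl -fmap_comp yab raddf0 oppr0.
by rewrite (susp_no_hom T_ct eta_iso g (tr0_retract t)) comp0r.
Qed.

Lemma hom_map_exact X1 X2 X3 (u : hom X1 X2) (v : hom X2 X3) w :
  distinguished u v w ->
  forall x, hom_map v x = 0 <-> exists z, hom_map u z = x.
Proof.
move=> uvw x; split=> [vx|[z <-]].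
  by have [z ->] := triangle_lift uvw (vx : v \c x = 0); exists z.
transitivity (v \c (u \c z)) => //.
by rewrite comp_assoc (triangle_comp0 uvw) comp0l.
Qed.

Lemma resolution_surj x : exists z, hom_map (tr_v t) z = x.
Proof.
have tri2 := (TR2 _ _ _).1 ((TR2 _ _ _).1 (tr_triangle t)).
have [z ->] := triangle_lift tri2
  (retract_susp0 T_ct (- 'S (tr_y t) \c x) (retract_of_self T) (tr1_retract t)).
by exists z.
Qed.

Definition resolution_two_step : two_step (hom_module (S Y)) (hom_module Y) :=
  TwoStep (hom_projective (tr1_retract t)) (hom_projective (tr0_retract t))
    resolution_inj (hom_map_exact (tr_triangle t))
    (hom_map_exact ((TR2 _ _ _).1 (tr_triangle t))) resolution_surj.

End ResolutionTwoStep.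

(** The map on [tr0] exists since there are no nonzero maps from [tr0 t] to the
    suspension of [tr1 t'].  In the triangles rotated to begin at [tr0], the
    prescribed ['S f] is the second component, so the third axiom completes it by
    a map on [tr1] compatible with [f] itself. *)
Lemma resolution_two_step_map Y Z (t : tilting_resolution T Y)
    (t' : tilting_resolution T Z) (f : hom Y Z) :
  two_step_map (resolution_two_step t) (resolution_two_step t')
    (hom_map ('S f)) (hom_map f).
Proof.
case: t t' => [T1 T0 y u v TT1 TT0 yuv] [T1' T0' y' u' v' TT1' TT0' yuv'].
have tri2 := (TR2 _ _ _).1 ((TR2 _ _ _).1 yuv).
have tri2' := (TR2 _ _ _).1 ((TR2 _ _ _).1 yuv').
have [g0 g0E] := triangle_lift tri2'
  (retract_susp0 T_ct (- 'S y' \c ('S f \c v)) TT0 TT1').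
have [h [hy hu]] := TR3 tri2 tri2' g0E.
have [g1 g1E] := susp_full h; rewrite -g1E in hy hu.
exists (hom_map g0), (hom_map g1); split=> x /=.
- transitivity (v' \c (g0 \c x)) => //.
  by rewrite comp_assoc -g0E -comp_assoc.
- transitivity (u' \c (g1 \c x)) => //.
  transitivity (g0 \c (u \c x)) => //.
  rewrite !comp_assoc; congr (_ \c _); apply: susp_inj; rewrite !fmap_comp.
  by apply: oppr_inj; rewrite -compNl -hu compNr.
- transitivity (y' \c (f \c x)) => //.
  transitivity (g1 \c (y \c x)) => //.
  rewrite !comp_assoc; congr (_ \c _); apply: susp_inj; rewrite !fmap_comp.
  by apply: oppr_inj; rewrite -compNl -hy compNr.
Qed.

Lemma hom_two_step : exists E : forall Y, two_step (hom_module (S Y)) (hom_module Y),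
  forall Y Z (f : hom Y Z), two_step_map (E Y) (E Z) (hom_map ('S f)) (hom_map f).
Proof.
exists (fun Y =>
  resolution_two_step (inhabited_witness (tilting_resolution_exists T_ct Y))).
by move=> Y Z f; apply: resolution_two_step_map.
Qed.

End HomModules.

(** * Rigid hyperpotentials *)

Section PathAlgebra.
Local Open Scope ring_scope.
Variables (Q : quiver) (K : fieldType).
Local Notation KQ := (complete_path_algebra Q K).
Local Notation e := (@cpa_idempotent Q K).
Implicit Types (x y z : KQ) (p : qpath Q).

(** The n-th power of the closed arrow ideal. *)
Definition arrow_power (n : nat) (x : KQ) : Prop :=
  forall p, (path_length p < n)%N -> x p = 0.

Lemma arrow_powerP n k x y :
  arrow_power n x -> arrow_power n y -> arrow_power n (k *: x + y).
Proof.
move=> nx ny p pn; transitivity (k * x p + y p) => //.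
by rewrite nx // ny // mulr0 addr0.
Qed.

Lemma arrow_powerM m n x y :
  arrow_power m x -> arrow_power n y -> arrow_power (m + n) (x * y).
Proof.
move=> mx ny p pmn; apply: big1 => k _.
have kp : (k <= path_length p)%N by rewrite -ltnS.
have [km|mk] := ltnP k m.
  by rewrite mx ?mul0r // path_take_length.
by rewrite ny ?mulr0 // path_drop_length ltn_subLR // (leq_trans pmn) // leq_add2r.
Qed.

Lemma arrow_powerMl n x y : arrow_power n y -> arrow_power n (x * y).
Proof. exact: (@arrow_powerM 0). Qed.

Lemma arrow_powerMr n x y : arrow_power n x -> arrow_power n (x * y).
Proof. by rewrite -{2}[n]addn0 => nx; apply: arrow_powerM. Qed.

Lemma arrow_powerX n x : arrow_power 1 x -> arrow_power n (x ^+ n).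
Proof.
move=> x1; elim: n => [|n IHn] //.
by rewrite exprS -add1n; apply: arrow_powerM.
Qed.

Lemma cpa_mul_trivial x y p : path_length p = 0%N -> (x * y) p = x p * y p.
Proof.
move=> p0; transitivity (cpa_mul x y p) => //.
rewrite /cpa_mul p0 big_ord_recl big_ord0 addr0 /= path_drop0.
by rewrite -{1}p0 path_take_size.
Qed.

(** Modulo the arrow ideal the path algebra is a product of copies of K, hence
    commutative. *)
Lemma commutator_arrow_power x y : arrow_power 1 (x * y - y * x).
Proof.
move=> p; rewrite ltnS leqn0 => /eqP p0.
transitivity ((x * y) p - (y * x) p) => //.
by rewrite !cpa_mul_trivial // mulrC subrr.
Qed.

Lemma cpa_idempotent_mul i x p :
  (e i * x) p = (path_source p == i)%:R * x p.
Proof.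
transitivity (cpa_mul (e i) x p) => //.
rewrite /cpa_mul big_ord_recl /= path_drop0 path_take0 big1 ?addr0.
  by rewrite /cpa_idempotent /= xpair_eqE eqxx andbT.
move=> k _; rewrite /cpa_idempotent.
have := @path_take_length Q (lift ord0 k) p (ltn_ord k).
case: eqP => [E|_ _]; last by rewrite mul0r.
by rewrite /path_length /path_arrows (congr1 snd E).
Qed.

Lemma cpa_idempotentM i j :
  e i * e j = (i == j)%:R *: e j.
Proof.
apply/funext => p; rewrite cpa_idempotent_mul.
transitivity ((i == j)%:R * e j p) => //.
rewrite /cpa_idempotent /path_source.
have [-> /=|_] := eqVneq (val p) (j, [::]); last by rewrite !mulr0.
by rewrite eq_sym.
Qed.

Lemma vertex_decomposition x :
  exists c : vertex Q -> K, arrow_power 1 (x - \sum_i c i *: e i).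
Proof.
pose c (i : vertex Q) : K := x (exist _ (i, [::]) isT).
exists c => p; rewrite ltnS leqn0 => p0.
transitivity (x p - \sum_i c i * e i p).
  transitivity (x p - (\sum_i c i *: e i) p) => //.
  congr (_ - _); elim/big_rec2: _ => // i y1 y2 _ <- //.
have pE : p = exist _ (path_source p, [::]) isT.
  by rewrite -path_take0 -(eqP p0) path_take_size.
rewrite (bigD1 (path_source p)) //= big1 => [|i ip].
  have -> : e (path_source p) p = 1 by rewrite /cpa_idempotent {1}pE /= eqxx.
  rewrite /c -pE mulr1 addr0; exact: subrr.
rewrite /cpa_idempotent pE /= xpair_eqE [path_source p == i]eq_sym.
by rewrite (negbTE ip) mulr0.
Qed.

End PathAlgebra.

Section AlgebraScaling.
Local Open Scope ring_scope.
Variables (K : fieldType) (A : fdAlgType K).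

Lemma fdalg_scalerAl k (x y : A) : k *: (x * y) = (k *: x) * y.
Proof. exact: alg_scaleAl. Qed.

Lemma fdalg_scalerAr k (x y : A) : k *: (x * y) = x * (k *: y).
Proof. exact: alg_scaleAr. Qed.

End AlgebraScaling.

Section JacobianAlgebra.
Local Open Scope ring_scope.
Variables (K : fieldType) (Q : quiver) (Lambda : fdAlgType K).
Local Notation KQ := (complete_path_algebra Q K).
Variables (rho : arrow Q -> KQ) (pi : {linear KQ -> Lambda}).
Hypothesis pres : jacobian_presentation rho pi.
Local Notation e := (@cpa_idempotent Q K).

Lemma pres1 : pi 1 = 1. Proof. by have [[]] := pres. Qed.
Lemma presM x y : pi (x * y) = pi x * pi y. Proof. by have [[]] := pres. Qed.
Lemma presX x n : pi (x ^+ n) = pi x ^+ n.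
Proof. by elim: n => [|n IHn]; rewrite ?expr0 ?pres1 // !exprS presM IHn. Qed.
Lemma pres_surj y : exists x, pi x = y. Proof. by have [] := pres. Qed.

Lemma pres_closed x :
  (forall n, exists y, pi y = 0 /\ arrow_power n (x - y)) -> pi x = 0.
Proof.
have [_ _ kerE] := pres; move=> xn; apply/kerE => n.
have [y [/kerE/(_ n) [z [Iz yz]] xy]] := xn n; exists z; split=> // p pn.
transitivity ((x - y) p + (y - z) p); last by rewrite xy // yz // addr0.
by transitivity (x p - y p + (y p - z p)); rewrite // addrA subrK.
Qed.

(** The images of the powers of the arrow ideal form a decreasing sequence of
    subspaces, which stabilizes.  An element of the stable power is congruent to
    elements of the kernel modulo every power, and the kernel is closed. *)
Lemma pres_nilpotent : exists N, forall x, arrow_power N x -> pi x = 0.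
Proof.
pose P n y := exists x, arrow_power n x /\ pi x = y.
have U_ex n : exists U : {vspace Lambda}, forall y, y \in U <-> P n y.
  apply: subspace_vspace; first by exists 0; rewrite raddf0.
  move=> k _ _ [x [nx <-]] [y [ny <-]]; exists (k *: x + y).
  by rewrite linearP; split=> //; apply: arrow_powerP.
have [U UE] := choice U_ex.
have U_dec m n : (m <= n)%N -> (U n <= U m)%VS.
  move=> mn; apply/subvP => y /UE[x [nx xy]]; apply/UE; exists x; split=> //.
  by move=> p pm; apply: nx; apply: leq_trans mn.
pose D d := `[< exists n, \dim (U n) = d >].
have D_ex : exists d, D d by exists (\dim (U 0%N)); apply/asboolP; exists 0%N.
case: (ex_minnP D_ex) => d /asboolP[N dimN] d_min; exists N => x Nx.
apply: pres_closed => n.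
have : pi x \in U (maxn N n).
  have /eqP -> : U (maxn N n) == U N.
    rewrite eqEdim U_dec ?leq_maxl //= dimN d_min //.
    by apply/asboolP; exists (maxn N n).
  by apply/UE; exists x.
move=> /(subvP (U_dec _ _ (leq_maxr _ _)))/UE[z [nz zx]].
exists (x - z); split; first by rewrite raddfB /= zx subrr.
by rewrite opprB addrC subrK.
Qed.

Lemma pres_arrow_nilpotent : exists N, forall x, arrow_power 1 x -> pi x ^+ N = 0.
Proof.
have [N N0] := pres_nilpotent; exists N => x x1.
by rewrite -presX N0 //; apply: arrow_powerX.
Qed.

(** In a simple right ideal, a nonzero [s * pi x] would generate [s] again, say
    [s = s * pi (x * z)]; iterating contradicts nilpotency. *)
Lemma semisimple_arrow0 : semisimple_algebra Lambda ->
  forall x, arrow_power 1 x -> pi x = 0.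
Proof.
move=> [n [S [S_simple _ S_full]]] x x1.
have [N N0] := pres_arrow_nilpotent.
have Sx i s : s \in S i -> s * pi x = 0.
  move=> sS; have [S_right _ S_min] := S_simple i.
  apply: contrapT => sx0.
  have [W WE] : exists W : {vspace Lambda},
      forall y, y \in W <-> exists a, s * pi x * a = y.
    apply: subspace_vspace; first by exists 0; rewrite mulr0.
    move=> k _ _ [a <-] [b <-]; exists (k *: a + b).
    by rewrite mulrDr -fdalg_scalerAr.
  have W_right : right_ideal W.
    by move=> u a /WE[b <-]; apply/WE; exists (b * a); rewrite mulrA.
  have WS : (W <= S i)%VS.
    by apply/subvP => y /WE[a <-]; do 2!apply: (S_right _ _).
  have [W0|WS'] := S_min W W_right WS.
    apply: sx0; apply/eqP; rewrite -memv0 -W0; apply/WE.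
    by exists 1; rewrite mulr1.
  have /WE[a sE] : s \in W by rewrite WS'.
  have [z zE] := pres_surj a.
  have sxz : s * pi (x * z) = s by rewrite presM zE mulrA.
  have sX k : s * pi (x * z) ^+ k = s.
    by elim: k => [|k IHk]; rewrite ?mulr1 // exprS mulrA sxz.
  apply: sx0; rewrite -(sX N) N0 ?mulr0 ?mul0r //.
  exact: arrow_powerMr.
have : (1 : Lambda) \in (\sum_(i < n) S i)%VS by rewrite S_full memvf.
case/memv_sumP => s sS oneE.
by rewrite -[pi x]mul1r oneE mulr_suml big1 // => i _; apply: (Sx i); apply: sS.
Qed.

Lemma pres_vertices x (c : vertex Q -> K) :
  pi (x - \sum_i c i *: e i) = pi x - \sum_i c i *: pi (e i).
Proof.
rewrite raddfB raddf_sum /=; congr (_ - _).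
by apply: eq_bigr => i _; rewrite linearZ.
Qed.

Lemma arrow0_rigid : (forall x, arrow_power 1 x -> pi x = 0) -> rigid pi.
Proof.
move=> arr0 y; have [x <-] := pres_surj y.
have [c xc] := vertex_decomposition x; exists c, [::].
by rewrite big_nil -pres_vertices arr0.
Qed.

Lemma commutator_sum_arrow y : commutator_sum y ->
  exists z, arrow_power 1 z /\ pi z = y.
Proof.
move=> [s ->]; elim: s => [|[a b] s [z [z1 zE]]].
  by exists 0; rewrite raddf0 big_nil.
have [a' aE] := pres_surj a; have [b' bE] := pres_surj b.
exists (1 *: (a' * b' - b' * a') + z); split.
  by apply: arrow_powerP z1; apply: commutator_arrow_power.
by rewrite scale1r raddfD /= raddfB /= !presM aE bE zE big_cons.
Qed.

Lemma pres_idempotentM i j : pi (e i) * pi (e j) = (i == j)%:R *: pi (e j).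
Proof. by rewrite -presM cpa_idempotentM linearZ. Qed.

(** Multiplying by [e i] shows that [c i *: pi (e i)] lies in a nilpotent ideal;
    an idempotent lies there only if it vanishes. *)
Lemma arrow_combination0 (c : vertex Q -> K) z :
  arrow_power 1 z -> \sum_i c i *: pi (e i) = pi z -> forall i, c i *: pi (e i) = 0.
Proof.
move=> z1 zE i.
have ciE : c i *: pi (e i) = pi (e i * z).
  rewrite presM -zE mulr_sumr (bigD1 i) //= big1 => [|j ji].
    by rewrite addr0 -fdalg_scalerAr
               pres_idempotentM eqxx scale1r.
  rewrite -fdalg_scalerAr.
  by rewrite pres_idempotentM eq_sym (negbTE ji) scale0r scaler0.
have [->|c0] := eqVneq (c i) 0; first exact: scale0r.
have [N N0] := pres_arrow_nilpotent.
have eE : pi (e i) = pi ((c i)^-1 *: (e i * z) + 0).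
  by rewrite addr0 linearZ /= -ciE scalerA mulVf // scale1r.
have : pi (e i) ^+ N.+1 = 0.
  rewrite exprS {2}eE N0 ?mulr0 //; apply: arrow_powerP => //.
  exact: arrow_powerMl.
suff -> : pi (e i) ^+ N.+1 = pi (e i) by move=> ->; rewrite scaler0.
elim: N {N0} => [|N IHN]; first by rewrite expr1.
by rewrite exprS IHN pres_idempotentM eqxx scale1r.
Qed.

(** Rigidity and the previous lemma put the image of the arrow ideal inside the
    commutators, on which the symmetrizing form vanishes; an ideal in the kernel
    of a nondegenerate form is 0. *)
Lemma rigid_arrow0 : symmetric_algebra Lambda -> rigid pi ->
  forall x, arrow_power 1 x -> pi x = 0.
Proof.
move=> /symmetrizing_form [tau [tauC tau_nd _]] rig.
have tau0 x : arrow_power 1 x -> tau (pi x) = 0.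
  move=> x1; have [c comm] := rig (pi x).
  have [z [z1 zE]] := commutator_sum_arrow comm.
  have c0 := @arrow_combination0 c (-1 *: z + x).
  rewrite big1 ?subr0 in comm; last first.
    move=> i _; apply: c0; first exact: arrow_powerP.
    by rewrite linearP /= zE scaleN1r opprB subrK.
  have [s ->] := comm; rewrite raddf_sum big1 // => -[a b] _ /=.
  by rewrite raddfB /= tauC subrr.
move=> x x1; apply: tau_nd => y; have [z <-] := pres_surj y.
by rewrite -presM; apply: tau0; apply: arrow_powerMr.
Qed.

(** The images of the trivial paths span, so the nonzero ones span simple right
    ideals of dimension one. *)
Lemma arrow0_semisimple : (forall x, arrow_power 1 x -> pi x = 0) ->
  semisimple_algebra Lambda.
Proof.
move=> arr0.
have span a : exists c : vertex Q -> K, a = \sum_i c i *: pi (e i).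
  have [x <-] := pres_surj a; have [c xc] := vertex_decomposition x.
  exists c; apply/eqP; rewrite -subr_eq0; apply/eqP.
  by rewrite -pres_vertices arr0.
have eM i a : exists k, pi (e i) * a = k *: pi (e i).
  have [c ->] := span a; exists (c i); rewrite mulr_sumr (bigD1 i) //=.
  rewrite big1 => [|j ji].
    by rewrite addr0 -fdalg_scalerAr
               pres_idempotentM eqxx scale1r.
  rewrite -fdalg_scalerAr.
  by rewrite pres_idempotentM eq_sym (negbTE ji) scale0r scaler0.
pose I := [set i | pi (e i) != 0]%SET.
pose v (k : 'I_#|I|) : vertex Q := enum_val k.
have v0 k : pi (e (v k)) != 0 by have := enum_valP k; rewrite inE.
exists #|I|, (fun k => <[pi (e (v k))]>%VS); split.
- move=> k; split.
  + move=> u a /vlineP[c ->]; have [d dE] := eM (v k) a.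
    rewrite -fdalg_scalerAl dE.
    by rewrite memvZ // memvZ // memv_line.
  + by move=> L0; have := memv_line (pi (e (v k))); rewrite L0 memv0 (negbTE (v0 k)).
  + move=> V _ VL; have [->|V0] := eqVneq V 0%VS; [by left | right].
    apply/eqP; rewrite eqEdim VL dim_vline v0 lt0n dimv_eq0 //.
- apply/directv_sum_independent => us usP us0 k _.
  have [c cE] := vlineP _ _ (usP k isT).
  have : pi (e (v k)) * (\sum_l us l) = us k.
    rewrite mulr_sumr (bigD1 k) //= big1 ?addr0 => [|l lk].
      rewrite cE -fdalg_scalerAr.
      by rewrite pres_idempotentM eqxx scale1r.
    have [d ->] := vlineP _ _ (usP l isT).
    rewrite -fdalg_scalerAr.
    rewrite pres_idempotentM (inj_eq enum_val_inj) eq_sym (negbTE lk).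
    by rewrite scale0r scaler0.
  by rewrite us0 mulr0.
- apply/eqP; rewrite eqEsubv subvf; apply/subvP => a _; have [c ->] := span a.
  apply: rpred_sum => i _; apply: memvZ.
  have [->|ei0] := eqVneq (pi (e i)) 0; first exact: mem0v.
  have iI : i \in I by rewrite inE.
  rewrite -(enum_rankK_in iI iI).
  apply: (subvP (sumv_sup (enum_rank_in iI i) _ (subvv _))) => //.
  exact: memv_line.
Qed.

Lemma rigid_semisimple : symmetric_algebra Lambda ->
  (rigid pi <-> semisimple_algebra Lambda).
Proof.
move=> sym; split=> [rig|ss].
  exact/arrow0_semisimple/rigid_arrow0.
exact/arrow0_rigid/semisimple_arrow0.
Qed.

End JacobianAlgebra.

(** * Fourth syzygies *)

Section SyzygyPeriodicity.
Local Open Scope ring_scope.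

Lemma stable_isomorphism_bijective (R : pzRingType) (M N : fgmod R)
    (f : {linear M -> N}) (g : {linear N -> M}) :
  cancel f g -> cancel g f -> stable_isomorphism f.
Proof.
by move=> fK gK; exists g; split; apply: stable_eq_ext => x /=; rewrite ?fK ?gK.
Qed.

(** A period of 3 is excluded, since together with the isomorphism of the fourth
    syzygy with [M] it would give period 1. *)
Lemma Omega_period_dvd4 (R : pzRingType) (Om : stable_functor R) (M : fgmod R) :
  stably_isomorphic (stable_pow Om 4 M) M ->
  exists r : nat, Omega_period Om M r /\ (r %| 4)%N.
Proof.
move=> iso4.
pose D r := (0 < r)%N && `[< stably_isomorphic (stable_pow Om r M) M >].
have D4 : D 4%N by apply/andP; split=> //; apply/asboolP.
have D_ex : exists r, D r by exists 4%N.
case: (ex_minnP D_ex) => r /andP[r0 /asboolP isor] r_min.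
exists r; split.
  split=> // q /andP[q0 qr] isoq; move: qr; rewrite ltnNge => /negP; apply.
  by apply: r_min; rewrite /D q0; apply/asboolP.
have := r_min _ D4; case: r r0 isor r_min => [|[|[|[|[|r]]]]] // _ iso3 r_min _.
have /r_min// : D 1%N.
apply/andP; split=> //; apply/asboolP.
apply: stably_isomorphic_trans iso4.
exact/stably_isomorphic_sym/(stable_functor_iso Om iso3).
Qed.

Variables (K : fieldType) (Lambda : fdAlgType K) (C : triangulated_category K).
Variable T : C.
Hypotheses (Lambda_sym : symmetric_algebra Lambda) (cy : calabi_yau2 C)
  (T_ct : cluster_tilting T) (Lambda_End : isomorphic_to_End Lambda T).
Local Notation S := (susp C).
Local Notation "''S' f" := (fmap (susp C) f) (at level 9, f at level 9).

(** For each [M] choose an isomorphism [th M] with Hom(T, S^2 Z).  Lifting it along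
    two-step sequences twice compares the fourth syzygy [Om^4 M] with Hom(T, Z),
    which [kappa] identifies with Hom(T, S^2 Z), that is, with [M]. *)
Lemma syzygy4_identity (Om : stable_functor (alg_sort Lambda)^c) :
  heller_functor Om ->
  natural_isomorphic (stable_pow Om 4) (stable_id (alg_sort Lambda)^c).
Proof.
move=> heller.
have [eta [eta_iso eta_nat]] := twist_iso_exists Lambda_sym cy T_ct Lambda_End.
have [phi [phi_bij phi1 phiM]] := Lambda_End.
have [EO EOP] := heller_two_step heller.
have [EF EFP] := hom_two_step T_ct phi_bij phi1 phiM eta_iso.
have [kappa [kappaE kappa_bij]] := hom_susp2 phi1 phiM eta_iso eta_nat.
pose F X := hom_module phi1 phiM X.
pose Ff X Y (f : hom X Y) : {linear F X -> F Y} := hom_map phi1 phiM f.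
have dense := hom_dense_susp2 T_ct phi_bij phi1 phiM.
pose Z (M : right_fgmod Lambda) : C := sval (cid (dense M)).
pose th (M : right_fgmod Lambda) : {linear M -> F (S (S (Z M)))} :=
  sval (cid (svalP (cid (dense M)))).
have th_ex (M : right_fgmod Lambda) : exists g : {linear F (S (S (Z M))) -> M},
    cancel (th M) g /\ cancel g (th M) := svalP (cid (svalP (cid (dense M)))).
pose th' (M : right_fgmod Lambda) : {linear F (S (S (Z M))) -> M} :=
  sval (cid (th_ex M)).
have thK (M : right_fgmod Lambda) : cancel (th M) (th' M) :=
  (svalP (cid (th_ex M))).1.
have th'K (M : right_fgmod Lambda) : cancel (th' M) (th M) :=
  (svalP (cid (th_ex M))).2.
have w1_ex (M : right_fgmod Lambda) :=
  two_step_map_exists (EO M) (EF (S (Z M))) (th M).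
pose w1 (M : right_fgmod Lambda) := sval (cid (w1_ex M)).
have w1P (M : right_fgmod Lambda) :
  two_step_map (EO M) (EF (S (Z M))) (th M) (w1 M) := svalP (cid (w1_ex M)).
have w2_ex (M : right_fgmod Lambda) :=
  two_step_map_exists (EO (Om (Om M))) (EF (Z M)) (w1 M).
pose w2 (M : right_fgmod Lambda) := sval (cid (w2_ex M)).
have w2P (M : right_fgmod Lambda) :
  two_step_map (EO (Om (Om M))) (EF (Z M)) (w1 M) (w2 M) := svalP (cid (w2_ex M)).
pose out (M : right_fgmod Lambda) : {linear F (Z M) -> M} := th' M \o kappa (Z M).
exists (fun M => lin_comp (out M) (w2 M)); split=> [M|M N f].
  apply: stable_isomorphism_comp.
    apply: (two_step_map_iso (w2P M)); apply: (two_step_map_iso (w1P M)).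
    exact: stable_isomorphism_bijective (thK M) (th'K M).
  have [k [kK k'K]] := kappa_bij (Z M).
  apply: (@stable_isomorphism_bijective _ _ _ _ (k \o th M)) => x /=.
    by rewrite th'K kK.
  by rewrite k'K thK.
(* Fullness of Hom(T, -) and of the suspension realizes [f] in the category. *)
have [g gE] : exists g : hom (Z M) (Z N),
    forall x, th N (f x) = Ff _ _ ('S ('S g)) (th M x).
  have [h hE] := hom_full T_ct phi_bij (th N \o (f \o th' M)).
  have [g1 g1E] := susp_full h; have [g gE] := susp_full g1; exists g => x.
  transitivity (h \c th M x); last by rewrite gE g1E.
  by rewrite -hE /= thK.
have [w [fw Omw]] := EOP _ _ f.
have [w' [ww' Omw']] := EOP _ _ w.
(* Both sides lift [th N \o f] from the covers of Heller to a triangle. *)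
have lift1 : stable_eq (lin_comp (w1 N) w) (lin_comp (Ff _ _ ('S g)) (w1 M)).
  apply: (two_step_map_stable (two_step_map_comp fw (w1P N))
           (two_step_map_comp (w1P M) (EFP _ _ ('S g)))).
  by apply: stable_eq_ext => x; apply: gE.
have lift2 : stable_eq (lin_comp (w2 N) w') (lin_comp (Ff _ _ g) (w2 M)).
  exact: (two_step_map_stable (two_step_map_comp ww' (w2P N))
           (two_step_map_comp (w2P M) (EFP _ _ g)) lift1).
have Om4f : stable_eq (stF_map (stable_pow Om 4) f) w'.
  by apply: stable_eq_trans Omw'; do 2!apply: stF_eq.
apply: stable_eq_trans (stable_eq_compl (lin_comp (out N) (w2 N)) Om4f) _.
apply: stable_eq_trans (stable_eq_compl (out N) lift2) _.
apply: stable_eq_ext => x; apply: (can_inj (thK N)) => /=.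
rewrite th'K gE th'K !kappaE.
transitivity ('S ('S g) \c ('S ('S (w2 M x)) \c eta)); last first.
  by rewrite -kappaE.
by rewrite /= !fmap_comp comp_assoc.
Qed.

End SyzygyPeriodicity.

Theorem proposition2p16 (K : fieldType) (Lambda : fdAlgType K)
    (C : triangulated_category K) (T : C)
    (Lambda_symmetric : symmetric_algebra Lambda)
    (C_krull_schmidt : krull_schmidt C)
    (C_calabi_yau : calabi_yau2 C)
    (T_cluster_tilting : cluster_tilting T)
    (Lambda_End : isomorphic_to_End Lambda T) :
  [/\ forall Omega : stable_functor (alg_sort Lambda)^c,
        heller_functor Omega ->
        natural_isomorphic (stable_pow Omega 4) (stable_id (alg_sort Lambda)^c) /\
        (forall M : right_fgmod Lambda, ~ projective M ->
           exists r : nat, Omega_period Omega M r /\ (r %| 4)%N),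
      forall X : C, isomorphic (susp C (susp C X)) X &
      forall (Q : quiver) (rho : arrow Q -> complete_path_algebra Q K)
        (pi : {linear complete_path_algebra Q K -> Lambda}),
        hyperpotential rho -> jacobian_presentation rho pi ->
        (rigid pi <-> semisimple_algebra Lambda)].
Proof.
split=> [Omega heller|X|Q rho pi _ pres]; last exact: rigid_semisimple pres _.
  have nat4 : natural_isomorphic (stable_pow Omega 4)
      (stable_id (alg_sort Lambda)^c).
    exact: (syzygy4_identity Lambda_symmetric C_calabi_yau T_cluster_tilting).
  split=> // M _; have [eta [eta_iso _]] := nat4.
  by apply: Omega_period_dvd4; exists (eta M).
have [eta [eta_iso eta_nat]] :=
  twist_iso_exists Lambda_symmetric C_calabi_yau T_cluster_tilting Lambda_End.
exact: (susp2_object T_cluster_tilting eta_iso eta_nat).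
Qed.
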